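(* Let $N\ge1$ and let $\mathrm{U}^{\circ}_z(\widehat{\mathfrak{gl}}_N)$ be the algebra over $\mathbb{C}[z,z^{-1}]$ defined below. Order the nonzero generators as follows: to each generator $t_{ia}^{(r)}$ or $\bar t_{ia}^{(r)}$ associate the triple $(i,a,r)$; a generator associated with $(i,a,r)$ precedes one associated with $(j,b,s)$ if $(i,a,r)<(j,b,s)$ lexicographically, and $t_{ia}^{(r)}$ precedes $\bar t_{ia}^{(r)}$ when both are nonzero. Consider the ordered monomials, i.e. products of generators taken in this order (with repetitions), excluding the zero generators $t_{ij}^{(0)}$ ($i<j$) and $\bar t_{ij}^{(0)}$ ($i>j$), and such that for each $i=1,\dots,N$ the monomial contains either a nonnegative power of $t_{ii}^{(0)}$ or a positive power of $\bar t_{ii}^{(0)}$ (but not both). These ordered monomials form a basis of $\mathrm{U}^{\circ}_z(\widehat{\mathfrak{gl}}_N)$ over $\mathbb{C}[z,z^{-1}]$.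
   Context: Let $z$ be an indeterminate and $E_{ij}$ the matrix units of size $N$. $R(u,v)=(u-v)\sum_{i\ne j}E_{ii}\otimes E_{jj}+(z^{-1}u-zv)\sum_iE_{ii}\otimes E_{ii}+(z^{-1}-z)u\sum_{i>j}E_{ij}\otimes E_{ji}+(z^{-1}-z)v\sum_{i<j}E_{ij}\otimes E_{ji}$. $\mathrm{U}^{\circ}_z(\widehat{\mathfrak{gl}}_N)$ is the associative $\mathbb{C}[z,z^{-1}]$-algebra with generators $t_{ij}^{(r)},\bar t_{ij}^{(r)}$ ($1\le i,j\le N$, $r\ge0$); with $t_{ij}(u)=\sum_rt_{ij}^{(r)}u^{-r}$, $\bar t_{ij}(u)=\sum_r\bar t_{ij}^{(r)}u^r$, $T(u)=\sum t_{ij}(u)\otimes E_{ij}$, $\overline T(u)=\sum\bar t_{ij}(u)\otimes E_{ij}$, the defining relations are $t_{ij}^{(0)}=\bar t_{ji}^{(0)}=0$ for $i<j$, $t_{ii}^{(0)}\bar t_{ii}^{(0)}=\bar t_{ii}^{(0)}t_{ii}^{(0)}=1$, and $R(u,v)T_1(u)T_2(v)=T_2(v)T_1(u)R(u,v)$, $R(u,v)\overline T_1(u)\overline T_2(v)=\overline T_2(v)\overline T_1(u)R(u,v)$, $R(u,v)\overline T_1(u)T_2(v)=T_2(v)\overline T_1(u)R(u,v)$ (with $T_1(u)=T(u)\otimes1$, $T_2(v)=1\otimes T(v)$, etc.). *)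

(* Defs.v *)
From HB Require Import structures.
From mathcomp Require Import all_boot all_order all_algebra.
From mathcomp Require Import fraction.
From mathcomp Require Import boolp.
From mathcomp Require Import complex.
From mathcomp Require Import Rstruct.
From mathcomp Require Import ring.

Set Implicit Arguments.
Unset Strict Implicit.
Unset Printing Implicit Defensive.

Import Order.TTheory GRing.Theory Num.Theory.
Local Open Scope ring_scope.

Local Notation "x %:F" := (@FracField.tofrac _ x).

Definition CC : Type := complex Rdefinitions.R.
HB.instance Definition _ := GRing.Field.on CC.

Definition Cz := {fraction {poly CC}}.

Definition is_laurent : pred Cz :=
  fun x => `[< exists (p : {poly CC}) (n : nat), x = p%:F / ('X ^+ n)%:F >].

Lemma Xn_frac_neq0 (n : nat) : (('X ^+ n : {poly CC})%:F : Cz) != 0.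
Proof. by rewrite tofrac_eq0 expf_neq0 // polyX_eq0. Qed.

Lemma is_laurent_subring : subring_closed is_laurent.
Proof.
split.
- apply/asboolP; exists 1, 0%N; by rewrite expr0 tofrac1 divr1.
- move=> x y /asboolP [p [n ->]] /asboolP [q [m ->]]; apply/asboolP.
  exists (p * 'X ^+ m - q * 'X ^+ n), (n + m)%N.
  rewrite exprD !tofracB !tofracM.
  by rewrite mulrBl [_ * ('X ^+ n)%:F]mulrC -!mulf_div !divff ?Xn_frac_neq0 // mulr1 mul1r.
- move=> x y /asboolP [p [n ->]] /asboolP [q [m ->]]; apply/asboolP.
  exists (p * q), (n + m)%N.
  by rewrite exprD !tofracM mulf_div.

Qed.

HB.instance Definition _ := GRing.isSubringClosed.Build Cz is_laurent
  is_laurent_subring.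

Record Laurent := MkLaurent { laurent_val :> Cz; laurent_valP : laurent_val \in is_laurent }.
HB.instance Definition _ := [isSub for laurent_val].
HB.instance Definition _ := [Choice of Laurent by <:].
HB.instance Definition _ := [SubChoice_isSubComNzRing of Laurent by <:].

Lemma z_laurent : ('X : {poly CC})%:F \in is_laurent.
Proof. apply/asboolP; exists 'X, 0%N; by rewrite expr0 tofrac1 divr1. Qed.

Lemma zinv_laurent : (('X : {poly CC})%:F)^-1 \in is_laurent.
Proof. apply/asboolP; exists 1, 1%N; by rewrite expr1 tofrac1 div1r. Qed.

Definition zL : Laurent := MkLaurent z_laurent.
Definition zLinv : Laurent := MkLaurent zinv_laurent.

Lemma zL_zLinv : zL * zLinv = 1.
Proof.
apply: val_inj => /=; rewrite mulfV //.
by rewrite tofrac_eq0 polyX_eq0.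
Qed.

(* Generators of U°_z(gl^_N).  A generator is a quadruple
   (bar, i, j, r) : bool * 'I_N * 'I_N * nat standing for
   t_{ij}^{(r)} when bar = false and \bar t_{ij}^{(r)} when bar = true.
   (Indices 1..N of the paper are 0..N-1 here.) *)
Definition gen (N : nat) : Type := (bool * 'I_N * 'I_N * nat)%type.

Definition gbar {N} (x : gen N) : bool := x.1.1.1.
Definition grow {N} (x : gen N) : 'I_N := x.1.1.2.
Definition gcol {N} (x : gen N) : 'I_N := x.1.2.
Definition gdeg {N} (x : gen N) : nat := x.2.

Section Relations.
Variables (N : nat) (A : algType Laurent) (g : gen N -> A).

(* coefficient of u^k in the series t_ij(u) = \sum_r t_ij^(r) u^-r
   (bar = false) or \bar t_ij(u) = \sum_r \bar t_ij^(r) u^r (bar = true) *)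
Definition ser_coef (bar : bool) (i j : 'I_N) (k : int) : A :=
  if bar then (if (0 <= k)%R then g (true, i, j, `|k|%N) else 0)
  else (if (k <= 0)%R then g (false, i, j, `|k|%N) else 0).

(* R(u,v) = \sum_{a,b,c,d} (Ru a c b d * u + Rv a c b d * v) E_ab (x) E_cd *)
Definition Ru (a c b d : 'I_N) : Laurent :=
  if (a == b) && (c == d) then (if a == c then zLinv else 1)
  else if [&& a == d, c == b & (c < a)%N] then zLinv - zL else 0.
Definition Rv (a c b d : 'I_N) : Laurent :=
  if (a == b) && (c == d) then (if a == c then - zL else -1)
  else if [&& a == d, c == b & (a < c)%N] then zLinv - zL else 0.

(* The coefficient of u^m v^n in the ((a,c),(b,d)) matrix entry of
   R(u,v) X_1(u) Y_2(v) - Y_2(v) X_1(u) R(u,v),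
   where X = T or \bar T (bx) and Y = T or \bar T (by). *)
Definition rtt_coef (bx by_ : bool) (a c b d : 'I_N) (m n : int) : A :=
  \sum_(p < N) \sum_(q < N)
     (Ru a c p q *: (ser_coef bx p b (m - 1) * ser_coef by_ q d n)
      + Rv a c p q *: (ser_coef bx p b m * ser_coef by_ q d (n - 1)))
  - \sum_(p < N) \sum_(q < N)
     (Ru p q b d *: (ser_coef by_ c q n * ser_coef bx a p (m - 1))
      + Rv p q b d *: (ser_coef by_ c q (n - 1) * ser_coef bx a p m)).

Definition defining_relations : Prop :=
  [/\ (forall i j : 'I_N, (i < j)%N -> g (false, i, j, 0%N) = 0),
      (forall i j : 'I_N, (i < j)%N -> g (true, j, i, 0%N) = 0),
      (forall i : 'I_N, g (false, i, i, 0%N) * g (true, i, i, 0%N) = 1),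
      (forall i : 'I_N, g (true, i, i, 0%N) * g (false, i, i, 0%N) = 1) &
      (forall (a c b d : 'I_N) (m n : int),
         [/\ rtt_coef false false a c b d m n = 0,
             rtt_coef true true a c b d m n = 0 &
             rtt_coef true false a c b d m n = 0])].

End Relations.

Definition presents_Uz (N : nat) (A : algType Laurent) (g : gen N -> A) : Prop :=
  defining_relations g /\
  forall (B : algType Laurent) (h : gen N -> B),
    defining_relations h ->
    exists f : {lrmorphism A -> B},
      (forall x, f (g x) = h x) /\
      (forall f' : {lrmorphism A -> B}, (forall x, f' (g x) = h x) -> f' =1 f).

Definition gen_le {N} (x y : gen N) : bool :=
  (grow x < grow y)%N ||
  ((grow x == grow y) &&
   ((gcol x < gcol y)%N ||
    ((gcol x == gcol y) &&
     ((gdeg x < gdeg y)%N ||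
      ((gdeg x == gdeg y) && (gbar x <= gbar y)%N))))).

Definition zero_gen {N} (x : gen N) : bool :=
  (gdeg x == 0%N) &&
  (if gbar x then (gcol x < grow x)%N else (grow x < gcol x)%N).

Definition ordered_monomial {N} (w : seq (gen N)) : bool :=
  [&& sorted gen_le w,
      all (fun x => ~~ zero_gen x) w &
      [forall i : 'I_N,
        ~~ (((false, i, i, 0%N) \in w) && ((true, i, i, 0%N) \in w))]].

Definition monomial {N} {A : algType Laurent} (g : gen N -> A)
  (w : seq (gen N)) : A := \prod_(x <- w) g x.

(* Main.v *)
(** Spanning.  The RTT relations express the product of two series in the wrong
    order, multiplied by u - v or z^-1 u - z v, through products in the right
    order.  As the series are one-sided, these factors can be divided out
    coefficient by coefficient over C[z,z^-1].  Straightening preserves the sum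
    of the matrix positions of the two factors and moves the smaller one to the
    left, so it terminates; generators in the same matrix position commute.

    Independence.  Let operators x_i, y_i, k_i of a q-oscillator algebra act on
    the C[z,z^-1]-valued functions on a lattice.  The matrix with off-diagonal
    entries x_i y_j, multiplied by u below the diagonal, and diagonal entries
    u k_i - k_i^-1 satisfies the RTT relation, and so does a product of such
    matrices acting on different lattices and with rescaled spectral parameters.
    Modulo z - 1 the constant function is a common eigenvector of their entries,
    and the matrix of eigenvalues is scalar outside one column.  When the
    spectral parameters run through all roots of unity of a large order, the
    scalar is 1 up to any prescribed order in u and u^-1; by interpolation such
    products realize all columns, hence all pairs of truncated series that are
    triangular in degree 0 with inverse diagonals.  Give the generators the
    values p^j for distinct primes p: the values of distinct ordered monomials
    at j = 1 are distinct, so a relation with coefficients c_w forces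
    c_w(1) = 0 for all w.  Dividing by z - 1 and iterating yields c_w = 0. *)

Require Import Defs.
From HB Require Import structures.
From mathcomp Require Import all_boot all_order all_algebra.
From mathcomp Require Import separable cyclotomic fraction boolp complex Rstruct.
From mathcomp Require Import zify ring.
Set Implicit Arguments.
Unset Strict Implicit.
Unset Printing Implicit Defensive.
Import Order.TTheory GRing.Theory Num.Theory.
Local Open Scope ring_scope.

(** * Straightening and the spanning property *)

(** The algebra is given only by a universal property, so its elements can be separated only by
    constructing other algebras that satisfy the relations. The representations must be defined over
    C[z,z^-1], and their values at z = 1 must reach every pair of triangular series up to a given
    degree. A block degenerates to one column at z = 1 because the oscillator relation fixes only
    the product of x_i and y_i: the factor that vanishes at z = 1 can be put into y_i for all
    columns but one. The obstacle is that the two series of a block are expansions, at infinity and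
    at zero, of one and the same matrix, so they cannot be chosen separately. Truncation at degree K
    frees them: the product of 1 - c X over all n-th roots of unity c is 1 - X^n, and for n > 2K the
    exponents r and -r with 1 <= r <= K lie in different classes modulo n, so n parameters prescribe
    both expansions. In the spanning part the delicate products are those of an unbarred by a barred
    generator: the relations contain them only on their right-hand side, where two unknown products
    can be coupled. *)

Section Span.
Variable V : lmodType Laurent.
Implicit Types (S : V -> Prop) (x y : V).

Inductive lspan S : V -> Prop :=
| lspan0 : lspan S 0
| lspan_cons c x y : S x -> lspan S y -> lspan S (c *: x + y).

Lemma lspan_gen S x : S x -> lspan S x.
Proof. by move=> Sx; rewrite -[x]scale1r -[_ *: _]addr0; apply: lspan_cons Sx (lspan0 S). Qed.

Lemma lspanD S x y : lspan S x -> lspan S y -> lspan S (x + y).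
Proof.
move=> sx sy; elim: sx => [|c u v Su _ IH]; first by rewrite add0r.
by rewrite -addrA; apply: lspan_cons.
Qed.

Lemma lspanZ S c x : lspan S x -> lspan S (c *: x).
Proof.
elim=> [|d u v Su _ IH]; first by rewrite scaler0; apply: lspan0.
by rewrite scalerDr scalerA; apply: lspan_cons.
Qed.

Lemma lspanN S x : lspan S x -> lspan S (- x).
Proof. by rewrite -scaleN1r; apply: lspanZ. Qed.

Lemma lspanB S x y : lspan S x -> lspan S y -> lspan S (x - y).
Proof. by move=> sx sy; apply: lspanD sx (lspanN sy). Qed.

Lemma lspan_trans S S' x :
  (forall u, S u -> lspan S' u) -> lspan S x -> lspan S' x.
Proof.
move=> sub; elim=> [|c u v Su _ IH]; first exact: lspan0.
by apply: lspanD IH; apply: lspanZ; apply: sub.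
Qed.

End Span.

Lemma lspanM (A : algType Laurent) (S S' S'' : A -> Prop) x y :
  (forall u v, S u -> S' v -> S'' (u * v)) ->
  lspan S x -> lspan S' y -> lspan S'' (x * y).
Proof.
move=> SM sx sy; elim: sx => [|c u v Su _ IH]; first by rewrite mul0r; apply: lspan0.
rewrite mulrDl; apply: lspanD IH; rewrite -scalerAl; apply: lspanZ.
elim: sy => [|d a b Sa _ IH]; first by rewrite mulr0; apply: lspan0.
rewrite mulrDr; apply: lspanD IH; rewrite -scalerAr; apply: lspanZ.
exact/lspan_gen/SM.
Qed.

Lemma zLinv_zL : zLinv * zL = 1.
Proof. by rewrite mulrC zL_zLinv. Qed.

Lemma int_ind_up (P : int -> Prop) :
  (forall m, m < 0 -> P m) -> (forall m, P (m - 1) -> P m) -> forall m, P m.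
Proof.
move=> P0 PS m; case: (ltP m 0) => [/P0 //|m0].
rewrite -(gez0_abs m0); elim: `|m|%N => [|k IH]; first by apply/PS/P0.
by apply: PS; rewrite -[k.+1]addn1 PoszD addrK.
Qed.

Lemma int_ind_down (P : int -> Prop) :
  (forall m, 0 < m -> P m) -> (forall m, P m -> P (m - 1)) -> forall m, P m.
Proof.
move=> P0 PS m; rewrite -[m]opprK.
elim/int_ind_up: (- m) => [k k0|k Pk]; first by apply: P0; rewrite oppr_gt0.
by rewrite (_ : - k = - (k - 1) - 1); [exact: PS | ring].
Qed.

Section FourTerms.
Variables (N : nat).
Implicit Types (a b c d : 'I_N).

Definition zdiag a c : Laurent := if a == c then zLinv else 1.
Definition zdiag' a c : Laurent := if a == c then zL else 1.
Definition kif (t : bool) : Laurent := if t then zLinv - zL else 0.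

Lemma sum_pick2 (V : nmodType) a c (x : V) :
  \sum_(p < N) \sum_(q < N) (if (p == a) && (q == c) then x else 0) = x.
Proof.
rewrite (bigD1 a) //= [X in _ + X]big1 => [|p /negPf pa]; last first.
  by rewrite big1 // => q _; rewrite pa.
by rewrite addr0 eqxx /= -big_mkcond big_pred1_eq.
Qed.

Lemma RuE a c p q :
  Ru a c p q = (if (p == a) && (q == c) then zdiag a c else 0) +
               (if (p == c) && (q == a) then kif (c < a)%N else 0).
Proof.
rewrite /Ru /zdiag /kif (eq_sym a p) (eq_sym c q) (eq_sym a q) (eq_sym c p).
case: (a =P c) => [<-|ac]; first by rewrite ltnn !andbF !if_same addr0.
have [/andP[/eqP-> /eqP->]|_] := boolP ((p == a) && (q == c)).
  by have /eqP/negPf-> := ac; rewrite /= addr0.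
by rewrite add0r andbCA; case: (c < a)%N; rewrite ?andbF ?andbT ?if_same.
Qed.

Lemma RvE a c p q :
  Rv a c p q = (if (p == a) && (q == c) then - zdiag' a c else 0) +
               (if (p == c) && (q == a) then kif (a < c)%N else 0).
Proof.
rewrite /Rv /zdiag' /kif (eq_sym a p) (eq_sym c q) (eq_sym a q) (eq_sym c p).
case: (a =P c) => [<-|ac]; first by rewrite ltnn !andbF !if_same addr0.
have [/andP[/eqP-> /eqP->]|_] := boolP ((p == a) && (q == c)).
  by have /eqP/negPf-> := ac; rewrite /= addr0.
by rewrite add0r andbCA; case: (a < c)%N; rewrite ?andbF ?andbT ?if_same.
Qed.

Lemma sum_Ru (V : lmodType Laurent) (F : 'I_N -> 'I_N -> V) a c :
  \sum_(p < N) \sum_(q < N) Ru a c p q *: F p q =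
  zdiag a c *: F a c + kif (c < a)%N *: F c a.
Proof.
rewrite -[X in X + _](sum_pick2 a c) -[X in _ + X](sum_pick2 c a) -big_split /=.
apply: eq_bigr => p _; rewrite -big_split /=; apply: eq_bigr => q _.
by rewrite RuE scalerDl; congr (_ + _); case: andP => [[/eqP-> /eqP->]|]; rewrite ?scale0r.
Qed.

Lemma sum_Rv (V : lmodType Laurent) (F : 'I_N -> 'I_N -> V) a c :
  \sum_(p < N) \sum_(q < N) Rv a c p q *: F p q =
  - zdiag' a c *: F a c + kif (a < c)%N *: F c a.
Proof.
rewrite -[X in X + _](sum_pick2 a c) -[X in _ + X](sum_pick2 c a) -big_split /=.
apply: eq_bigr => p _; rewrite -big_split /=; apply: eq_bigr => q _.
by rewrite RvE scalerDl; congr (_ + _); case: andP => [[/eqP-> /eqP->]|]; rewrite ?scale0r.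
Qed.

Lemma sum_Ru' (V : lmodType Laurent) (F : 'I_N -> 'I_N -> V) b d :
  \sum_(p < N) \sum_(q < N) Ru p q b d *: F p q =
  zdiag b d *: F b d + kif (b < d)%N *: F d b.
Proof.
rewrite -[X in X + _](sum_pick2 b d) -[X in _ + X](sum_pick2 d b) -big_split /=.
apply: eq_bigr => p _; rewrite -big_split /=; apply: eq_bigr => q _.
rewrite RuE (eq_sym b p) (eq_sym d q) (eq_sym b q) (eq_sym d p) [(q == b) && _]andbC.
rewrite scalerDl; congr (_ + _).
  by case: andP => [[/eqP-> /eqP->]|]; rewrite ?scale0r.
by case: andP => [[/eqP-> /eqP->]|]; rewrite ?scale0r.
Qed.

Lemma sum_Rv' (V : lmodType Laurent) (F : 'I_N -> 'I_N -> V) b d :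
  \sum_(p < N) \sum_(q < N) Rv p q b d *: F p q =
  - zdiag' b d *: F b d + kif (d < b)%N *: F d b.
Proof.
rewrite -[X in X + _](sum_pick2 b d) -[X in _ + X](sum_pick2 d b) -big_split /=.
apply: eq_bigr => p _; rewrite -big_split /=; apply: eq_bigr => q _.
rewrite RvE (eq_sym b p) (eq_sym d q) (eq_sym b q) (eq_sym d p) [(q == b) && _]andbC.
rewrite scalerDl; congr (_ + _).
  by case: andP => [[/eqP-> /eqP->]|]; rewrite ?scale0r.
by case: andP => [[/eqP-> /eqP->]|]; rewrite ?scale0r.
Qed.

End FourTerms.

Section Straightening.
Variables (N : nat) (A : algType Laurent) (g : gen N -> A).
Hypothesis rels : defining_relations g.
Implicit Types (a b c d : 'I_N) (m n : int).

(** [R] has only diagonal entries and entries that exchange two indices, so each double sum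
    collapses. The hypothesis excludes just the pair (T, \bar T), for which no relation is
    imposed. *)
Lemma rtt4 bx by_ a b c d m n : (by_ ==> bx) ->
  zdiag a c *: (ser_coef g bx a b (m - 1) * ser_coef g by_ c d n)
  - zdiag' a c *: (ser_coef g bx a b m * ser_coef g by_ c d (n - 1))
  + (kif (c < a)%N *: (ser_coef g bx c b (m - 1) * ser_coef g by_ a d n)
     + kif (a < c)%N *: (ser_coef g bx c b m * ser_coef g by_ a d (n - 1)))
  = zdiag b d *: (ser_coef g by_ c d n * ser_coef g bx a b (m - 1))
  - zdiag' b d *: (ser_coef g by_ c d (n - 1) * ser_coef g bx a b m)
  + (kif (b < d)%N *: (ser_coef g by_ c b n * ser_coef g bx a d (m - 1))
     + kif (d < b)%N *: (ser_coef g by_ c b (n - 1) * ser_coef g bx a d m)).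
Proof.
move=> bxy; have : rtt_coef g bx by_ a c b d m n = 0.
  by case: rels => _ _ _ _ /(_ a c b d m n) []; move: bxy; case: bx; case: by_.
move/subr0_eq.
under eq_bigr => p _ do rewrite big_split /=.
under [X in _ = X -> _]eq_bigr => p _ do rewrite big_split /=.
rewrite !big_split /= sum_Ru sum_Rv sum_Ru' sum_Rv' !scaleNr => E.
by rewrite addrACA E addrACA.
Qed.

Lemma lspan_zL (V : lmodType Laurent) (S : V -> Prop) (x : V) :
  lspan S (zL *: x) -> lspan S x.
Proof. by move=> /(@lspanZ _ _ zLinv); rewrite scalerA zLinv_zL scale1r. Qed.

Lemma lspan_zLinv (V : lmodType Laurent) (S : V -> Prop) (x : V) :
  lspan S (zLinv *: x) -> lspan S x.
Proof. by move=> /(@lspanZ _ _ zL); rewrite scalerA zL_zLinv scale1r. Qed.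

Lemma lspan_zdiag (V : lmodType Laurent) (S : V -> Prop) b d (x : V) :
  lspan S (zdiag b d *: x) -> lspan S x.
Proof. by rewrite /zdiag; case: eqP => _; [apply: lspan_zLinv | rewrite scale1r]. Qed.

Lemma lspan_zdiag' (V : lmodType Laurent) (S : V -> Prop) b d (x : V) :
  lspan S (zdiag' b d *: x) -> lspan S x.
Proof. by rewrite /zdiag'; case: eqP => _; [apply: lspan_zL | rewrite scale1r]. Qed.

(* Coefficientwise division by [z^-1 u - z v] (if [b = d]) or [u - v]; the
   recursion starts where the one-sided series [F] vanishes. *)
Lemma lspan_div (V : lmodType Laurent) (S : V -> Prop) (bx : bool) b d
    (F : int -> int -> V) :
  (forall m n, (if bx then m < 0 else 0 < m) -> F m n = 0) ->
  (forall m n, lspan S (zdiag b d *: F (m - 1) n - zdiag' b d *: F m (n - 1))) ->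
  forall m n, lspan S (F m n).
Proof.
move=> F0 FS; case: bx F0 => F0.
  elim/int_ind_up => [m m0 n|m IH n]; first by rewrite F0 //; apply: lspan0.
  have := lspanB (lspanZ (zdiag b d) (IH (n + 1))) (FS m (n + 1)).
  by rewrite opprB addrC subrK addrK => /lspan_zdiag'.
elim/int_ind_down => [m m0 n|m IH n]; first by rewrite F0 //; apply: lspan0.
have := lspanD (FS m n) (lspanZ (zdiag' b d) (IH (n - 1))).
by rewrite subrK => /lspan_zdiag.
Qed.

(** Exchanging the rows or the columns of two positions keeps the sum of their numbers, and the
    relations permute indices in no other way. *)
Definition pkey a b : nat := (a * N + b)%N.

Lemma pkey_row a c d : (c < a)%N -> (pkey c d < a * N)%N.
Proof.
by rewrite /pkey => ca; have := ltn_ord d; have := leq_mul ca (leqnn N); rewrite mulSn; lia.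
Qed.

Definition pair_below (s k : nat) (t : A) : Prop :=
  exists x y : gen N, [/\ t = g x * g y,
    (pkey (grow x) (gcol x) + pkey (grow y) (gcol y) = s)%N &
    (pkey (grow x) (gcol x) < k)%N].

Lemma lspan_ser bx by_ a b c d m n s k :
  (pkey a b + pkey c d = s)%N -> (pkey a b < k)%N ->
  lspan (pair_below s k) (ser_coef g bx a b m * ser_coef g by_ c d n).
Proof.
move=> es lk; rewrite /ser_coef.
case: bx by_ => [] [];
 (case: ifP => _; last by rewrite mul0r; apply: lspan0);
 (case: ifP => _; last by rewrite mulr0; apply: lspan0);
 by apply: lspan_gen; eexists; eexists; split.
Qed.

Lemma ser0 bx a b m : (if bx then m < 0 else 0 < m) -> ser_coef g bx a b m = 0.
Proof. by rewrite /ser_coef; case: bx => m0; rewrite lt_geF. Qed.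

Lemma pair_below_le s s' k k' t :
  s = s' -> (k <= k')%N -> pair_below s k t -> lspan (pair_below s' k') t.
Proof.
move=> <- kk' [x [y [-> e lt]]]; apply: lspan_gen; exists x, y; split=> //.
exact: leq_trans kk'.
Qed.

(** Apart from the two terms to be divided, every term of [rtt4] has a left factor in row [c]. The
    bound is the start of row [a] rather than the position of the left factor, so that it does not
    depend on the columns. *)
Lemma span_rowF bx by_ a b c d m n : (by_ ==> bx) -> (c < a)%N ->
  lspan (pair_below (pkey a b + pkey c d) (a * N))
    (ser_coef g bx a b m * ser_coef g by_ c d n).
Proof.
move=> bxy ca; move: m n.
apply: (@lspan_div _ _ bx a c) => [m n m0|m n]; first by rewrite ser0 ?mul0r.
have /(canRL (addrK _))-> := rtt4 a b c d m n bxy.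
rewrite ca (ltnNge a) (ltnW ca) scale0r addr0.
by do ![apply: lspanD | apply: lspanB | apply: lspanN | apply: lspanZ];
   (apply: lspan_ser; [rewrite /pkey; lia | exact: pkey_row]).
Qed.

Lemma subr_subDK (V : zmodType) (x y k : V) : x - (x - y + k) + k = y.
Proof. by rewrite opprD opprB [y - x]addrC !addrA subrr add0r subrK. Qed.

(** This serves unbarred times barred products. The term of the left-hand side that still begins in
    row [c] is reduced by [span_rowF]; on the right-hand side the products with columns (d, b) and
    (b, d) remain coupled. *)
Lemma span_rowG by_ a b c d m n : (a < c)%N ->
  lspan (pair_below (pkey c d + pkey a b) (c * N))
    (ser_coef g by_ c d n * ser_coef g true a b m).
Proof.
move=> ac; have bxy : by_ ==> true by apply: implybT.
set S := pair_below _ _.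
have lhs b' d' m' n' : (b' + d' = b + d)%N ->
  lspan S
  (zdiag b' d' *: (ser_coef g by_ c d' n' * ser_coef g true a b' (m' - 1))
  - zdiag' b' d' *: (ser_coef g by_ c d' (n' - 1) * ser_coef g true a b' m')
  + (kif (b' < d')%N *: (ser_coef g by_ c b' n' * ser_coef g true a d' (m' - 1))
     + kif (d' < b')%N *: (ser_coef g by_ c b' (n' - 1) * ser_coef g true a d' m'))).
  move=> bd; rewrite -rtt4 // ac (ltnNge c) (ltnW ac) scale0r add0r.
  apply: lspanD; [apply: lspanB; apply: lspanZ|apply: lspanZ].
  - by apply: lspan_ser; [rewrite /pkey; lia | exact: pkey_row].
  - by apply: lspan_ser; [rewrite /pkey; lia | exact: pkey_row].
  apply: lspan_trans (span_rowF _ _ _ _ bxy ac) => t.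
  by apply: pair_below_le => //; rewrite /pkey; lia.
have [bd|bd] := eqVneq b d.
  move: m n; apply: (@lspan_div _ S true b d
    (fun m n => ser_coef g by_ c d n * ser_coef g true a b m)) => [m n m0|m n].
    by rewrite [X in _ * X]ser0 ?mulr0.
  by have := lhs b d m n erefl; rewrite -bd ltnn scale0r scale0r !addr0.
(* Both coupled products are treated in one induction on the exponent of the second factor. In the
   relation for the first, the coupling term has the previous exponent; in the relation for the
   second, it is the product just obtained. *)
have main b' d' : (b' < d')%N -> (b' + d' = b + d)%N -> forall m n,
    lspan S (ser_coef g by_ c d' n * ser_coef g true a b' m) /\
    lspan S (ser_coef g by_ c b' n * ser_coef g true a d' m).
  move=> ltbd bd'; have /negPf nbd : b' != d' by apply: contraTneq ltbd => ->; rewrite ltnn.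
  elim/int_ind_up => [k k0 l|k IH l].
    by rewrite ![ser_coef g true _ _ _]ser0 // !mulr0; split; apply: lspan0.
  have [IH1 IH2] := IH (l + 1).
  have := lhs b' d' k (l + 1) bd'; have := lhs d' b' k (l + 1).
  rewrite /zdiag /zdiag' nbd eq_sym nbd ltbd (ltnNge d') (ltnW ltbd) /= !scale1r !scale0r addr0 add0r addrK.
  rewrite addnC => /(_ bd') L2 L1.
  have H1 : lspan S (ser_coef g by_ c d' l * ser_coef g true a b' k).
    have := lspanD (lspanB IH1 L1) (lspanZ (kif true) IH2).
    by rewrite subr_subDK.
  split=> //; have := lspanD (lspanB IH2 L2) (lspanZ (kif true) H1).
  by rewrite subr_subDK.
case: (ltngtP b d) bd => [lt|lt|/val_inj->] bd; last by rewrite eqxx in bd.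
  by have [] := main b d lt erefl m n.
by have [] := main d b lt (addnC _ _) m n.
Qed.

Lemma span_colG bx by_ a b d m n : (by_ ==> bx) -> (b < d)%N ->
  lspan (pair_below (pkey a d + pkey a b) (pkey a d))
    (ser_coef g by_ a d n * ser_coef g bx a b m).
Proof.
move=> bxy bd; set S := pair_below _ _.
have nbd : b == d = false by apply/negP => /eqP E; rewrite E ltnn in bd.
move: m n; apply: (@lspan_div _ S bx b d
    (fun m n => ser_coef g by_ a d n * ser_coef g bx a b m)) => [m n m0|m n].
  by rewrite [X in _ * X]ser0 ?mulr0.
have /esym/(canRL (addrK _))-> := rtt4 a b a d m n bxy.
rewrite ltnn scale0r scale0r addr0 addr0 (ltnNge d) (ltnW bd) scale0r addr0.
by do ![apply: lspanD | apply: lspanB | apply: lspanN | apply: lspanZ];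
   (apply: lspan_ser; rewrite /pkey; lia).
Qed.

(** The exchange term on the right-hand side still has the larger column on its left; it has the
    shape that [span_colG] reduces. *)
Lemma span_colF bx by_ a b d m n : (by_ ==> bx) -> (d < b)%N ->
  lspan (pair_below (pkey a b + pkey a d) (pkey a b))
    (ser_coef g bx a b m * ser_coef g by_ a d n).
Proof.
move=> bxy db; set S := pair_below _ _; move: m n.
apply: (@lspan_div _ S bx a a) => [m n m0|m n]; first by rewrite ser0 ?mul0r.
have := rtt4 a b a d m n bxy.
rewrite ltnn !scale0r !addr0 db (ltnNge b) (ltnW db) scale0r add0r => ->.
do ![apply: lspanD | apply: lspanB | apply: lspanN | apply: lspanZ].
- by apply: lspan_ser; rewrite /pkey; lia.
- by apply: lspan_ser; rewrite /pkey; lia.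
apply: lspan_trans (span_colG _ _ _ bxy db) => t.
by apply: pair_below_le => //; rewrite /pkey; lia.
Qed.

Lemma ser_comm bx by_ a b m n : (by_ ==> bx) ->
  ser_coef g bx a b m * ser_coef g by_ a b n =
  ser_coef g by_ a b n * ser_coef g bx a b m.
Proof.
move=> bxy; apply/subr0_eq.
(* The span of the empty set is zero, so [lspan_div] also proves identities: here the commutator is
   annihilated by z^-1 u - z v. *)
have span_false (x : A) : lspan (fun=> False) x -> x = 0 by elim.
apply/span_false; move: m n; apply: (@lspan_div _ _ bx a a
  (fun m n => ser_coef g bx a b m * ser_coef g by_ a b n -
              ser_coef g by_ a b n * ser_coef g bx a b m)) => [m n m0|m n].
  by rewrite ser0 // mul0r mulr0 subrr.
have := rtt4 a b a b m n bxy.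
rewrite !ltnn !scale0r !addr0 /zdiag /zdiag' !eqxx => E.
by rewrite !scalerBr opprD addrACA E -opprD subrr; apply: lspan0.
Qed.

Definition gkey (x : gen N) := pkey (grow x) (gcol x).

Lemma gen_ser (x : gen N) :
  g x = ser_coef g (gbar x) (grow x) (gcol x)
          (if gbar x then Posz (gdeg x) else - Posz (gdeg x)).
Proof.
case: x => [[[[] a] b] r]; rewrite /ser_coef /= ?abszN ?absz_nat //.
by rewrite oppr_le0.
Qed.

Lemma gkeyP (x y : gen N) :
  gkey x = gkey y -> grow x = grow y /\ gcol x = gcol y.
Proof.
rewrite /gkey => e; case: (ltngtP (grow x) (grow y)) => [lt|lt|/val_inj rr].
- by have := pkey_row (gcol x) lt; rewrite e /pkey ltnNge leq_addr.
- by have := pkey_row (gcol y) lt; rewrite -e /pkey ltnNge leq_addr.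
by split=> //; move: e; rewrite rr /pkey => /addnI/val_inj.
Qed.

Lemma gen_comm (x y : gen N) : gkey x = gkey y -> g x * g y = g y * g x.
Proof.
move=> /gkeyP[rr cc]; rewrite !gen_ser rr cc.
have [yx|] := boolP (gbar y ==> gbar x); first exact: ser_comm.
by rewrite negb_imply => /andP[-> /negPf->]; apply/esym/ser_comm.
Qed.

Lemma gen_swap (x y : gen N) : (gkey y < gkey x)%N ->
  lspan (pair_below (gkey x + gkey y) (gkey x)) (g x * g y).
Proof.
move=> lt; rewrite (gen_ser x) (gen_ser y).
set m := (if gbar x then _ else _); set n := (if gbar y then _ else _).
case: (ltngtP (grow x) (grow y)) => [row|row|/val_inj row].
- by have := pkey_row (gcol x) row; move: lt; rewrite /gkey /pkey; lia.
- have [yx|] := boolP (gbar y ==> gbar x).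
    apply: lspan_trans (span_rowF _ _ _ _ yx row) => t.
    by apply: pair_below_le => //; rewrite /gkey /pkey leq_addr.
  rewrite negb_imply => /andP[-> /negPf->].
  apply: lspan_trans (span_rowG _ _ _ _ _ row) => t.
  by apply: pair_below_le => //; rewrite /gkey /pkey leq_addr.
have col : (gcol y < gcol x)%N by move: lt; rewrite /gkey /pkey row ltn_add2l.
rewrite /gkey row; have [yx|] := boolP (gbar y ==> gbar x); first exact: span_colF.
by rewrite negb_imply => /andP[-> /negPf->]; apply: span_colG.
Qed.

Definition mon_in (Q : pred (seq (gen N))) (t : A) : Prop :=
  exists2 w, Q w & t = monomial g w.

Lemma monomial_cat u v : monomial g (u ++ v) = monomial g u * monomial g v.
Proof. exact: big_cat. Qed.

Lemma monomial_cons x u : monomial g (x :: u) = g x * monomial g u.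
Proof. exact: big_cons. Qed.

(* An adjacent exchange that keeps the sum of [f] and decreases [f] on the left
   factor decreases this weight. *)
Fixpoint weight (f : gen N -> nat) (w : seq (gen N)) : nat :=
  if w is x :: w' then ((size w') * f x + weight f w')%N else 0%N.

(** The lexicographic order on (degree, bar) as a single number, since [gbar x] is 0 or 1. *)
Definition gfine (x : gen N) : nat := ((gdeg x).*2 + gbar x)%N.

Lemma weight_swap f u v x y x' y' :
  (f x + f y = f x' + f y')%N -> (f x' < f x)%N ->
  (weight f (u ++ x' :: y' :: v) < weight f (u ++ x :: y :: v))%N.
Proof.
move=> e lt; elim: u => [|t u IH] /=; first by nia.
by rewrite !size_cat /= ltn_add2l.
Qed.

Lemma weight_eq f u v x y x' y' : f x = f x' -> f y = f y' ->
  weight f (u ++ x' :: y' :: v) = weight f (u ++ x :: y :: v).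
Proof.
move=> ex ey; elim: u => [|t u IH] /=; first by rewrite ex ey.
by rewrite !size_cat /= IH.
Qed.

Lemma gen_leE (x y : gen N) :
  gen_le x y = (gkey x < gkey y)%N || ((gkey x == gkey y) && (gfine x <= gfine y)%N).
Proof.
have fine : (gfine x <= gfine y)%N =
    (gdeg x < gdeg y)%N || (gdeg x == gdeg y) && (gbar x <= gbar y)%N.
  by rewrite /gfine; case: (gbar x) (gbar y) => [] []; lia.
rewrite /gen_le fine /gkey; case: (ltngtP (grow x) (grow y)) => [lt|lt|/val_inj->] /=.
- by have := pkey_row (gcol x) lt; rewrite /pkey; lia.
- have := pkey_row (gcol y) lt; rewrite /pkey -val_eqE /= => lt'.
  by rewrite gtn_eqF ?ltnNge; lia.
by rewrite eqxx /= /pkey ltn_add2l eqn_add2l.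
Qed.

Lemma not_sorted_adj (w : seq (gen N)) : ~~ sorted gen_le w ->
  exists u v x y, w = u ++ x :: y :: v /\ ~~ gen_le x y.
Proof.
case: w => // x w; elim: w x => //= y w IH x; rewrite negb_and.
case: (boolP (gen_le x y)) => [_ /=|nxy _]; last by exists [::], w, x, y.
by move=> /IH[u [v [x' [y' [-> n]]]]]; exists (x :: u), v, x', y'.
Qed.

Lemma zero_gen0 x : zero_gen x -> g x = 0.
Proof.
have [t0 tb0 _ _ _] := rels; case: x => [[[b i] j] r]; rewrite /zero_gen /=.
by case/andP=> /eqP->; case: b => /=; [apply: tb0|apply: t0].
Qed.

Lemma gen_le_trans : transitive (@gen_le N).
Proof. by move=> y x t; rewrite !gen_leE; lia. Qed.

Lemma gen_le_anti : antisymmetric (@gen_le N).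
Proof.
move=> x y; rewrite !gen_leE => H.
have [/gkeyP[er ec] ef] : gkey x = gkey y /\ gfine x = gfine y by lia.
case: x y er ec ef {H} => [[[b i] j] r] [[[b' i'] j'] r']; rewrite /grow /gcol /gfine /= => -> -> e.
have [-> ->] : r = r' /\ b = b' by case: b b' e => [] [] /= e; split=> //; lia.
by [].
Qed.

(** t_ii^(0) and its inverse are consecutive in the order on generators, so in a sorted word only
    copies of the two can stand between them; the cut is made after the last copy of t_ii^(0). *)
Lemma adjacent_inverses (w : seq (gen N)) (i : 'I_N) : sorted gen_le w ->
  (false, i, i, 0%N) \in w -> (true, i, i, 0%N) \in w ->
  exists u v, w = u ++ (false, i, i, 0%N) :: (true, i, i, 0%N) :: v.
Proof.
set t : gen N := (false, i, i, 0%N); set tb : gen N := (true, i, i, 0%N).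
have between y : gen_le t y -> gen_le y tb -> y = t \/ y = tb.
  have ek : gkey tb = gkey t by []. have ft : gfine t = 0%N by []. have ftb : gfine tb = 1%N by [].
  rewrite !gen_leE => H1 H2; case: (posnP (gfine y)) => [f0|f1]; [left|right];
    by apply: gen_le_anti; rewrite !gen_leE; lia.
rewrite sorted_pairwise; last exact: gen_le_trans.
elim: w => //= x w IH /andP[/allP le_x pw]; rewrite !inE.
have [tw _|tNw] := boolP (t \in w).
  case/predU1P => [xtb|tbw]; last by have [u [v ->]] := IH pw tw tbw; exists (x :: u), v.
  have := @gen_le_anti t tb; rewrite {2}xtb le_x // andbT gen_leE ltnn eqxx.
  by move=> /(_ isT).
rewrite orbF => /eqP tx /= tbw; rewrite -tx in le_x tbw *; exists [::]; case: w tNw {IH} tbw pw le_x => //= y w.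
rewrite inE negb_or => /andP[ty _] tbw /andP[/allP le_y _] le_t; exists w.
have ty' : gen_le t y by apply: le_t; rewrite inE eqxx.
have tby : gen_le y tb.
  by case/predU1P: tbw => [<-|/le_y //]; rewrite gen_leE ltnn eqxx leqnn.
have [E|-> //] := between y ty' tby.
by rewrite E eqxx in ty.
Qed.

(** Lexicographic induction on length, weight by position and weight by [gfine]. Cancelling t_ii^(0)
    against its inverse lowers the first; exchanging generators in different positions keeps the
    first and lowers the second, whatever it does to degrees; commuting generators in one position
    keeps the first two and lowers the third. *)
Lemma span_ordered w : lspan (mon_in ordered_monomial) (monomial g w).
Proof.
move: {2}(size w) (erefl (size w)) => sz.
elim/ltn_ind: sz w => sz IHsz w.
move: {2}(weight gkey w) (erefl (weight gkey w)) => k1.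
elim/ltn_ind: k1 w => k1 IH1 w.
move: {2}(weight gfine w) (erefl (weight gfine w)) => k2.
elim/ltn_ind: k2 w => k2 IH2 w ek2 ek1 esz.
have [srt|/not_sorted_adj[u [v [x [y [ew nle]]]]]] := boolP (sorted gen_le w); last first.
  move: nle; rewrite gen_leE; case: (ltngtP (gkey x) (gkey y)) => //= [lt _|e].
    rewrite ew monomial_cat !monomial_cons [g x * _]mulrA.
    have tri S t s r : lspan S t -> (forall t', S t' -> lspan (mon_in ordered_monomial) (r * (t' * s))) ->
        lspan (mon_in ordered_monomial) (r * (t * s)).
      move=> St H; elim: St => [|c a b Sa _ IH]; first by rewrite mul0r mulr0; apply: lspan0.
      rewrite mulrDl mulrDr; apply: lspanD IH.
      by rewrite -scalerAl -scalerAr; apply/lspanZ/H.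
    apply: tri (gen_swap lt) _ => _ [x' [y' [-> es lt']]].
    rewrite -mulrA -!monomial_cons -monomial_cat.
    apply: (IH1 _ _ _ erefl); last by rewrite -esz ew !size_cat.
    by rewrite -ek1 ew; apply: weight_swap.
  rewrite -ltnNge => lt.
  rewrite ew monomial_cat !monomial_cons [g x * _]mulrA gen_comm // -mulrA -!monomial_cons -monomial_cat.
  apply: (IH2 _ _ _ erefl).
  - by rewrite -ek2 ew; apply: weight_swap => //; rewrite addnC.
  - by rewrite -ek1 ew; apply: weight_eq.
  by rewrite -esz ew !size_cat.
have [nz|/allPn[x xw]] := boolP (all (fun x => ~~ zero_gen x) w); last first.
  rewrite negbK => zx; case/splitPr: xw => u v.
  by rewrite monomial_cat monomial_cons zero_gen0 // mul0r mulr0; apply: lspan0.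
have [ex|] := boolP [forall i : 'I_N,
        ~~ (((false, i, i, 0%N) \in w) && ((true, i, i, 0%N) \in w))].
  by apply: lspan_gen; exists w => //; apply/and3P.
case/forallPn => i; rewrite negbK => /andP[tw tbw].
have [u [v ew]] := adjacent_inverses srt tw tbw.
rewrite ew monomial_cat !monomial_cons mulrA.
have [_ _ -> _ _] := rels; rewrite mul1r -monomial_cat.
apply: (IHsz _ _ _ erefl).
by rewrite -esz ew !size_cat /= !addnS; lia.
Qed.

End Straightening.

(** * A presented algebra is spanned by the monomials in its generators *)

Section Generated.
Variables (N : nat) (A : algType Laurent) (g : gen N -> A).

Definition in_gen : pred A := fun x => `[< lspan (mon_in g predT) x >].

Lemma in_genP x : reflect (lspan (mon_in g predT) x) (x \in in_gen).
Proof. exact: asboolP. Qed.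

Lemma in_gen_subalg : GRing.subsemialg_closed in_gen.
Proof.
apply: GRing.subalg_closed_semi; split=> [|c x y /in_genP sx /in_genP sy|x y /in_genP sx /in_genP sy].
- by apply/in_genP/lspan_gen; exists [::] => //; rewrite /monomial big_nil.
- exact/in_genP/lspanD/sy/lspanZ.
apply/in_genP; apply: lspanM sx sy => _ _ [u _ ->] [v _ ->].
by exists (u ++ v) => //; rewrite monomial_cat.
Qed.

HB.instance Definition _ := GRing.isSubalgClosed.Build Laurent A in_gen in_gen_subalg.

Record gensub := MkGen { gensub_val :> A; gensubP : gensub_val \in in_gen }.
HB.instance Definition _ := [isSub for gensub_val].
HB.instance Definition _ := [Choice of gensub by <:].
HB.instance Definition _ := [SubChoice_isSubAlgebra of gensub by <:].

Lemma gen_in_gen x : g x \in in_gen.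
Proof. by apply/in_genP/lspan_gen; exists [:: x] => //; rewrite /monomial big_seq1. Qed.

Definition gen_gensub x : gensub := MkGen (gen_in_gen x).

End Generated.

Definition gval N (A : algType Laurent) (g : gen N -> A) : gensub g -> A := val.
HB.instance Definition _ N A g :=
  GRing.RMorphism.copy (@gval N A g) (val : gensub g -> A).
HB.instance Definition _ N A g :=
  GRing.Linear.copy (@gval N A g) (val : gensub g -> A).

Lemma ser_coef_morph N (A B : algType Laurent) (f : {lrmorphism A -> B}) (g : gen N -> A) (h : gen N -> B)
    b i j k :
  (forall x, f (g x) = h x) -> f (ser_coef g b i j k) = ser_coef h b i j k.
Proof. by move=> fg; rewrite /ser_coef; case: b; case: ifP; rewrite ?raddf0 ?fg. Qed.

Lemma rtt_coef_morph N (A B : algType Laurent) (f : {lrmorphism A -> B}) (g : gen N -> A) (h : gen N -> B)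
    bx by_ a c b d m n :
  (forall x, f (g x) = h x) ->
  f (rtt_coef g bx by_ a c b d m n) = rtt_coef h bx by_ a c b d m n.
Proof.
have fD x y : f (x + y) = f x + f y by apply: raddfD.
have fB x y : f (x - y) = f x - f y by apply: raddfB.
have fZ r x : f (r *: x) = r *: f x by apply: linearZ.
have fM x y : f (x * y) = f x * f y by apply: rmorphM.
have fsum := big_morph f fD (raddf0 f).
move=> fg; rewrite /rtt_coef fB !fsum; congr (_ - _); apply: eq_bigr => p _;
  rewrite fsum; apply: eq_bigr => q _;
  by rewrite fD !fZ !fM !(ser_coef_morph _ _ _ _ fg).
Qed.

Lemma relations_inj N (A B : algType Laurent) (f : {lrmorphism A -> B}) (g : gen N -> A) (h : gen N -> B) :
  injective f -> (forall x, f (g x) = h x) ->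
  defining_relations h -> defining_relations g.
Proof.
move=> f_inj fg [h1 h2 h3 h4 h5].
have f0 : f 0 = 0 by apply: raddf0.
have f1 : f 1 = 1 by apply: rmorph1.
have fM x y : f (x * y) = f x * f y by apply: rmorphM.
split.
- by move=> i j ij; apply: f_inj; rewrite fg f0 h1.
- by move=> i j ij; apply: f_inj; rewrite fg f0 h2.
- by move=> i; apply: f_inj; rewrite fM !fg h3 f1.
- by move=> i; apply: f_inj; rewrite fM !fg h4 f1.
move=> a c b d m n; have [e1 e2 e3] := h5 a c b d m n.
by split; apply: f_inj; rewrite (rtt_coef_morph _ _ _ _ _ _ _ _ fg) f0.
Qed.

(** The universal property gives a morphism from [A] to the subalgebra of combinations of monomials.
    Followed by the inclusion it fixes the generators, so by uniqueness it is the identity. *)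
Lemma presents_generated N (A : algType Laurent) (g : gen N -> A) :
  presents_Uz g -> forall x, lspan (mon_in g predT) x.
Proof.
case=> rels univ x.
have rels' : defining_relations (@gen_gensub N A g).
  by apply: (@relations_inj _ _ _ (@gval N A g) _ g) rels => //; apply: val_inj.
have [f [fg _]] := univ _ _ rels'.
have [id' [_ id'P]] := univ _ _ rels.
have := id'P (@gval N A g \o f) (fun x => congr1 val (fg x)) x.
rewrite -(id'P (idfun : A -> A) (fun=> erefl) x) /= => <-.
exact/in_genP/gensubP.
Qed.

Lemma lspan_monomials N (A : algType Laurent) (g : gen N -> A) Q x :
  lspan (mon_in g Q) x ->
  exists (ws : seq (seq (gen N))) (c : seq (gen N) -> Laurent),
    all Q ws /\ x = \sum_(w <- ws) c w *: monomial g w.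
Proof.
(* A coefficient depends on the word and not on its place in the list, so without repetitions a new
   term can be merged into the coefficient of a word already listed. *)
move=> sx; suff [ws [c [_ Qws ->]]] : exists (ws : seq (seq (gen N))) (c : seq (gen N) -> Laurent),
    [/\ uniq ws, all Q ws & x = \sum_(w <- ws) c w *: monomial g w] by exists ws, c.
elim: sx => [|a _ y [w Qw ->] _ [ws [c [Uws Qws ->]]]].
  by exists [::], (fun=> 0); rewrite big_nil.
pose d u := (if u == w then a else 0) + c u.
have [w_ws|wNws] := boolP (w \in ws).
  exists ws, d; split=> //; rewrite !(bigD1_seq w) //= /d eqxx scalerDl -addrA; congr (_ + (_ + _)).
  by apply: eq_bigr => u /negPf->; rewrite add0r.
exists (w :: ws), (fun u => if u == w then a else c u); split; rewrite /= ?wNws ?Qw //.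
rewrite big_cons eqxx; congr (_ + _); rewrite big_seq [RHS]big_seq; apply: eq_bigr => u u_ws.
by case: eqP u_ws wNws => // -> ->.
Qed.

Lemma ordered_monomials_span N (A : algType Laurent) (g : gen N -> A) :
  presents_Uz g -> forall x : A,
  exists (ws : seq (seq (gen N))) (c : seq (gen N) -> Laurent),
    all ordered_monomial ws /\ x = \sum_(w <- ws) c w *: monomial g w.
Proof.
move=> pres x; apply: lspan_monomials.
apply: lspan_trans (presents_generated pres x) => _ [w _ ->].
by case: pres => rels _; apply: span_ordered.
Qed.

(** * Endomorphisms of the space of functions on a product of lattices *)

Section Endomorphisms.
Variable N : nat.

(** A point of a product of countably many lattices Z^N. With one lattice for each block, products
    of any number of blocks live in a single algebra. *)
Definition site := nat -> 'I_N -> int.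
Definition state := site -> Laurent.

Definition state_linear (f : state -> state) :=
  forall (c : Laurent) (u v : state) n, f (fun m => c * u m + v m) n = c * f u n + f v n.

Record endo := Endo { app :> state -> state; appP : state_linear app }.

Lemma endoP (f g : endo) : (forall u n, f u n = g u n) -> f = g.
Proof.
case: f g => [f fP] [g gP] /= fg.
have e : f = g by apply/funext => u; apply/funext => n.
by rewrite e in fP *; rewrite (Prop_irrelevance fP gP).
Qed.

HB.instance Definition _ := gen_eqMixin endo.
HB.instance Definition _ := gen_choiceMixin endo.

Lemma zero_linear : state_linear (fun _ _ => 0).
Proof. by move=> c u v n; rewrite mulr0 addr0. Qed.
Lemma one_linear : state_linear (fun u => u).
Proof. by []. Qed.
Lemma add_linear (f g : endo) : state_linear (fun u n => f u n + g u n).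
Proof. by move=> c u v n; rewrite !appP mulrDr addrACA. Qed.
Lemma opp_linear (f : endo) : state_linear (fun u n => - f u n).
Proof. by move=> c u v n; rewrite appP opprD mulrN. Qed.
Lemma scale_linear a (f : endo) : state_linear (fun u n => a * f u n).
Proof. by move=> c u v n; rewrite appP mulrDr mulrCA. Qed.
Lemma comp_linear (f g : endo) : state_linear (fun u => f (g u)).
Proof.
move=> c u v n; rewrite -appP; congr (f _ n).
by apply/funext => m; rewrite appP.
Qed.

Definition endo_zero := Endo zero_linear.
Definition endo_one := Endo one_linear.
Definition endo_add f g := Endo (add_linear f g).
Definition endo_opp f := Endo (opp_linear f).
Definition endo_scale a f := Endo (scale_linear a f).
Definition endo_comp f g := Endo (comp_linear f g).

Lemma endo_addA : associative endo_add.
Proof. by move=> f g h; apply: endoP => u n /=; rewrite addrA. Qed.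
Lemma endo_addC : commutative endo_add.
Proof. by move=> f g; apply: endoP => u n /=; rewrite addrC. Qed.
Lemma endo_add0 : left_id endo_zero endo_add.
Proof. by move=> f; apply: endoP => u n /=; rewrite add0r. Qed.
Lemma endo_addN : left_inverse endo_zero endo_opp endo_add.
Proof. by move=> f; apply: endoP => u n /=; rewrite addNr. Qed.
HB.instance Definition _ :=
  GRing.isZmodule.Build endo endo_addA endo_addC endo_add0 endo_addN.

Lemma endo_compA : associative endo_comp.
Proof. by move=> f g h; apply: endoP. Qed.
Lemma endo_comp1f : left_id endo_one endo_comp.
Proof. by move=> f; apply: endoP. Qed.
Lemma endo_compf1 : right_id endo_one endo_comp.
Proof. by move=> f; apply: endoP. Qed.
Lemma endo_compDl : left_distributive endo_comp endo_add.
Proof. by move=> f g h; apply: endoP. Qed.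
Lemma endo_compDr : right_distributive endo_comp endo_add.
Proof.
move=> f g h; apply: endoP => u n /=.
rewrite -[f (g u) n]mul1r -appP; congr (f _ n).
by apply/funext => m; rewrite mul1r.
Qed.
Lemma endo_one_neq0 : endo_one != 0.
Proof.
apply/eqP => /(congr1 (fun f : endo => f (fun=> 1) (fun _ _ => 0))) /=.
by apply/eqP; rewrite oner_eq0.
Qed.
HB.instance Definition _ :=
  GRing.Zmodule_isNzRing.Build endo endo_compA endo_comp1f endo_compf1
    endo_compDl endo_compDr endo_one_neq0.

Lemma endo_scaleA a b f : endo_scale a (endo_scale b f) = endo_scale (a * b) f.
Proof. by apply: endoP => u n /=; rewrite mulrA. Qed.
Lemma endo_scale1 : left_id 1 endo_scale.
Proof. by move=> f; apply: endoP => u n /=; rewrite mul1r. Qed.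
Lemma endo_scaleDr : right_distributive endo_scale +%R.
Proof. by move=> a f g; apply: endoP => u n /=; rewrite mulrDr. Qed.
Lemma endo_scaleDl f : {morph endo_scale^~ f : a b / a + b}.
Proof. by move=> a b; apply: endoP => u n /=; rewrite mulrDl. Qed.
HB.instance Definition _ :=
  GRing.Zmodule_isLmodule.Build Laurent endo endo_scaleA endo_scale1
    endo_scaleDr endo_scaleDl.

Lemma endo_scaleAl a (f g : endo) : a *: (f * g) = (a *: f) * g.
Proof. by apply: endoP. Qed.
HB.instance Definition _ :=
  GRing.Lmodule_isLalgebra.Build Laurent endo endo_scaleAl.
Lemma endo_scaleAr a (f g : endo) : a *: (f * g) = f * (a *: g).
Proof.
apply: endoP => u n /=; rewrite -[RHS]addr0 -(mulr0 a).
have f0 : f (fun=> 0) n = 0.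
  have := appP f (-1) (fun=> 0) (fun=> 0) n; rewrite mulr0 addr0 => ->.
  by rewrite mulN1r addNr.
rewrite mulr0 -[X in _ = _ + X]f0.
have := appP f a (g u) (fun=> 0) n; rewrite f0 !addr0 => <-.
by congr (f _ n); apply/funext => m; rewrite addr0.
Qed.
HB.instance Definition _ := GRing.Lalgebra_isAlgebra.Build Laurent endo endo_scaleAr.

End Endomorphisms.

(** * The q-oscillator solution of the RTT relation *)

Definition zp (k : int) : Laurent :=
  match k with Posz n => zL ^+ n | Negz n => zLinv ^+ n.+1 end.

Lemma zp_succ k : zp (k + 1) = zL * zp k.
Proof.
case: k => n; first by rewrite -PoszD addn1 /= exprS.
have -> : Negz n + 1 = - Posz n by rewrite NegzE; lia.
case: n => [|n]; first by rewrite oppr0 /= expr1 zL_zLinv.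
by rewrite -NegzE /= [in RHS]exprS mulrA zL_zLinv mul1r.
Qed.

Lemma zp_pred k : zp (k - 1) = zLinv * zp k.
Proof. by rewrite -[in RHS](subrK 1 k) zp_succ mulrA zLinv_zL mul1r. Qed.

Lemma zpD j k : zp (j + k) = zp j * zp k.
Proof.
elim/int_rec: j => [|n IH|n IH]; first by rewrite add0r mul1r.
  by rewrite -addn1 PoszD addrAC !zp_succ IH mulrA.
by rewrite -addn1 PoszD opprD addrAC !zp_pred IH mulrA.
Qed.

Lemma zpNr k : zp k * zp (- k) = 1.
Proof. by rewrite -zpD subrr. Qed.

Section Kernels.
Variables (N : nat).
Implicit Types (a b c d l : 'I_N) (nu : 'I_N -> int).

Definition sh1 a b nu : 'I_N -> int :=
  fun l => nu l - Posz (val l == val a) + Posz (val l == val b).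

(* Exponents of the Jordan-Wigner phases of the oscillators: with them the
   entries [ell a b] below factor as x_a y_b. *)
Definition om a nu : int := \sum_(l < N | (l < a)%N) nu l.

Lemma om_sh1 c a b nu : om c (sh1 a b nu) = om c nu - Posz (a < c)%N + Posz (b < c)%N.
Proof.
have pick (x : 'I_N) : \sum_(l < N | (l < c)%N) Posz (val l == val x) = Posz (x < c)%N.
  case: (boolP (x < c)%N) => xc.
    rewrite (bigD1 x) //= eqxx big1 ?addr0 // => l /andP[_ /negPf].
    by rewrite -val_eqE => ->.
  rewrite big1 // => l lc; case: eqP => // e; by rewrite -e lc in xc.
by rewrite /om /sh1 big_split /= sumrB !pick.
Qed.

Variables (kap kap' : 'I_N -> Laurent) (al be : 'I_N -> int -> Laurent).
Hypothesis al_be : forall l n, al l n * be l (n - 1) = kap l * zp n - kap' l * zp (- n).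

(** For a different from b this is the coefficient of the operator x_a y_b. The hypothesis on [al]
    and [be] is the q-oscillator relation; it leaves free how the product is split between the
    two. *)
Definition ell a b nu : Laurent :=
  al a (nu a) * be b (nu b) * (zp (om a nu) * zp (- om b nu) * zp (Posz (a < b)%N)).

(** [Mlow] and [Mupp] are the coefficients of the solution u [Mlow] - [Mupp]; the minus sign in
    [Mupp] makes all its off-diagonal entries equal to [ell], up to the factor u below the
    diagonal. *)
Definition Mlow a b nu : Laurent :=
  if (b < a)%N then ell a b nu else if val a == val b then kap a * zp (nu a) else 0.
Definition Mupp a b nu : Laurent :=
  if (a < b)%N then - ell a b nu else if val a == val b then kap' a * zp (- nu a) else 0.

Lemma al_be_succ l n :
  al l (n + 1) * be l n = kap l * (zL * zp n) - kap' l * (zLinv * zp (- n)).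
Proof. by have := al_be l (n + 1); rewrite addrK zp_succ opprD zp_pred. Qed.

Ltac index_cases a b c d :=
  case: (ltngtP a b) => ?; (try case: (ltngtP a c) => ?); (try case: (ltngtP b c) => ?);
  try (exfalso; lia);
  (try case: (ltngtP a d) => ?); (try case: (ltngtP b d) => ?); (try case: (ltngtP c d) => ?);
  try (exfalso; lia);
  repeat match goal with H : nat_of_ord ?x = nat_of_ord ?y |- _ =>
    move/val_inj: H => H; subst end.

Ltac kernel_simpl :=
  rewrite /= ?mul0r ?mulr0 ?addr0 ?sub0r ?mul1r ?subr0 ?oppr0 ?expr0 ?expr1 ?mulr1 ?subrK
    ?opprD ?opprK ?zp_succ ?zp_pred.

Definition kmul (X Y : 'I_N -> 'I_N -> ('I_N -> int) -> Laurent) a b c d nu : Laurent :=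
  X a b nu * Y c d (sh1 a b nu).

(** The RTT relation with R replaced by its coefficient at u; [kminus] uses the coefficient at v.
    All products involved translate the lattice point by the same vector, so it is enough to compare
    their coefficients. *)
Definition kplus (X Y : 'I_N -> 'I_N -> ('I_N -> int) -> Laurent) a b c d nu : Laurent :=
  zdiag a c * kmul X Y a b c d nu + kif (c < a)%N * kmul X Y c b a d nu -
  (zdiag b d * kmul Y X c d a b nu + kif (b < d)%N * kmul Y X c b a d nu).

Definition kminus (X Y : 'I_N -> 'I_N -> ('I_N -> int) -> Laurent) a b c d nu : Laurent :=
  - zdiag' a c * kmul X Y a b c d nu + kif (a < c)%N * kmul X Y c b a d nu -
  (- zdiag' b d * kmul Y X c d a b nu + kif (d < b)%N * kmul Y X c b a d nu).

(** The RTT relation for u [Mlow] - [Mupp] splits into one identity for each monomial in u and v.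
    This is u^2 v; the next four lemmas are u, u^2, v^2 and uv, and [kminus_same] adds u v^2 and v.
    Each identity depends only on the relative order of the four indices. *)
Lemma kernel_low_low a b c d nu : kplus Mlow Mlow a b c d nu = 0.
Proof.
have [Wa Wb Wc Wd] := And4 (zpNr (om a nu)) (zpNr (om b nu)) (zpNr (om c nu)) (zpNr (om d nu)).
have [Fa Fb Fc Fd] := And4 (al_be a (nu a)) (al_be b (nu b)) (al_be c (nu c)) (al_be d (nu d)).
have [Ga Gb Gc Gd] := And4 (al_be_succ a (nu a)) (al_be_succ b (nu b))
  (al_be_succ c (nu c)) (al_be_succ d (nu d)).
have Z := zLinv_zL.
rewrite /kplus /kminus /kmul /Mlow /Mupp /ell !om_sh1 /sh1 /zdiag /zdiag' /kif -!val_eqE /=.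
index_cases a b c d; kernel_simpl; try reflexivity.
all: ring: Wa Wb Wc Wd Fa Fb Fc Fd Ga Gb Gc Gd Z.
Qed.

Lemma kernel_upp_upp a b c d nu : kplus Mupp Mupp a b c d nu = 0.
Proof.
have [Wa Wb Wc Wd] := And4 (zpNr (om a nu)) (zpNr (om b nu)) (zpNr (om c nu)) (zpNr (om d nu)).
have [Fa Fb Fc Fd] := And4 (al_be a (nu a)) (al_be b (nu b)) (al_be c (nu c)) (al_be d (nu d)).
have [Ga Gb Gc Gd] := And4 (al_be_succ a (nu a)) (al_be_succ b (nu b))
  (al_be_succ c (nu c)) (al_be_succ d (nu d)).
have Z := zLinv_zL.
rewrite /kplus /kminus /kmul /Mlow /Mupp /ell !om_sh1 /sh1 /zdiag /zdiag' /kif -!val_eqE /=.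
index_cases a b c d; kernel_simpl; try reflexivity.
all: ring: Wa Wb Wc Wd Fa Fb Fc Fd Ga Gb Gc Gd Z.
Qed.

Lemma kernel_low_upp a b c d nu : kplus Mlow Mupp a b c d nu = 0.
Proof.
have [Wa Wb Wc Wd] := And4 (zpNr (om a nu)) (zpNr (om b nu)) (zpNr (om c nu)) (zpNr (om d nu)).
have [Fa Fb Fc Fd] := And4 (al_be a (nu a)) (al_be b (nu b)) (al_be c (nu c)) (al_be d (nu d)).
have [Ga Gb Gc Gd] := And4 (al_be_succ a (nu a)) (al_be_succ b (nu b))
  (al_be_succ c (nu c)) (al_be_succ d (nu d)).
have Z := zLinv_zL.
rewrite /kplus /kminus /kmul /Mlow /Mupp /ell !om_sh1 /sh1 /zdiag /zdiag' /kif -!val_eqE /=.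
index_cases a b c d; kernel_simpl; try reflexivity.
all: ring: Wa Wb Wc Wd Fa Fb Fc Fd Ga Gb Gc Gd Z.
Qed.

Lemma kernel_upp_low a b c d nu : kminus Mupp Mlow a b c d nu = 0.
Proof.
have [Wa Wb Wc Wd] := And4 (zpNr (om a nu)) (zpNr (om b nu)) (zpNr (om c nu)) (zpNr (om d nu)).
have [Fa Fb Fc Fd] := And4 (al_be a (nu a)) (al_be b (nu b)) (al_be c (nu c)) (al_be d (nu d)).
have [Ga Gb Gc Gd] := And4 (al_be_succ a (nu a)) (al_be_succ b (nu b))
  (al_be_succ c (nu c)) (al_be_succ d (nu d)).
have Z := zLinv_zL.
rewrite /kplus /kminus /kmul /Mlow /Mupp /ell !om_sh1 /sh1 /zdiag /zdiag' /kif -!val_eqE /=.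
index_cases a b c d; kernel_simpl; try reflexivity.
all: ring: Wa Wb Wc Wd Fa Fb Fc Fd Ga Gb Gc Gd Z.
Qed.

Lemma kernel_mixed a b c d nu : kplus Mupp Mlow a b c d nu + kminus Mlow Mupp a b c d nu = 0.
Proof.
have [Wa Wb Wc Wd] := And4 (zpNr (om a nu)) (zpNr (om b nu)) (zpNr (om c nu)) (zpNr (om d nu)).
have [Fa Fb Fc Fd] := And4 (al_be a (nu a)) (al_be b (nu b)) (al_be c (nu c)) (al_be d (nu d)).
have [Ga Gb Gc Gd] := And4 (al_be_succ a (nu a)) (al_be_succ b (nu b))
  (al_be_succ c (nu c)) (al_be_succ d (nu d)).
have Z := zLinv_zL.
rewrite /kplus /kminus /kmul /Mlow /Mupp /ell !om_sh1 /sh1 /zdiag /zdiag' /kif -!val_eqE /=.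
index_cases a b c d; kernel_simpl; try reflexivity.
all: ring: Wa Wb Wc Wd Fa Fb Fc Fd Ga Gb Gc Gd Z.
Qed.

(** The sum of the coefficients of R at u and v is z^-1 - z times the flip, and the flip intertwines
    X_1 X_2 with X_2 X_1 for every X. *)
Lemma kminus_same X a b c d nu : kminus X X a b c d nu = - kplus X X a b c d nu.
Proof.
rewrite /kplus /kminus /zdiag /zdiag' /kif -!val_eqE.
case: (ltngtP a c) => [?|?|/val_inj <-]; case: (ltngtP b d) => [?|?|/val_inj <-];
  ring.
Qed.
End Kernels.

(** * The RTT relation over an arbitrary ring *)

Definition central (S : nzRingType) (k : S) := forall x, k * x = x * k.

Section RTT.
Variables (N : nat) (S : nzRingType).
Implicit Types (rho : 'I_N -> 'I_N -> 'I_N -> 'I_N -> S) (X Y : 'I_N -> 'I_N -> S).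
Implicit Types (a b c d : 'I_N) (k : S).

Lemma centralM k k' : central k -> central k' -> central (k * k').
Proof. by move=> ck ck' x; rewrite -mulrA ck' mulrA ck mulrA. Qed.

Lemma central1 : central (1 : S).
Proof. by move=> x; rewrite mul1r mulr1. Qed.

Definition rtt rho X Y a b c d : S :=
  \sum_(p < N) \sum_(q < N) rho a c p q * (X p b * Y q d) -
  \sum_(p < N) \sum_(q < N) rho p q b d * (Y c q * X a p).

Lemma rttDrho rho rho' X Y a b c d :
  rtt (fun a c b d => rho a c b d + rho' a c b d) X Y a b c d =
  rtt rho X Y a b c d + rtt rho' X Y a b c d.
Proof.
rewrite /rtt addrACA -opprD -!big_split /=; congr (_ - _); apply: eq_bigr => p _;
  by rewrite -big_split; apply: eq_bigr => q _; rewrite mulrDl.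
Qed.

Lemma rttDl rho X X' Y a b c d :
  rtt rho (fun a b => X a b + X' a b) Y a b c d =
  rtt rho X Y a b c d + rtt rho X' Y a b c d.
Proof.
rewrite /rtt addrACA -opprD -!big_split /=; congr (_ - _); apply: eq_bigr => p _;
  by rewrite -big_split; apply: eq_bigr => q _; rewrite ?mulrDl !mulrDr.
Qed.

Lemma rttDr rho X Y Y' a b c d :
  rtt rho X (fun a b => Y a b + Y' a b) a b c d =
  rtt rho X Y a b c d + rtt rho X Y' a b c d.
Proof.
rewrite /rtt addrACA -opprD -!big_split /=; congr (_ - _); apply: eq_bigr => p _;
  by rewrite -big_split; apply: eq_bigr => q _; rewrite ?mulrDl !mulrDr.
Qed.

Lemma rttMrho rho X Y a b c d k :
  rtt (fun a c b d => k * rho a c b d) X Y a b c d = k * rtt rho X Y a b c d.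
Proof.
rewrite /rtt mulrBr !mulr_sumr; congr (_ - _); apply: eq_bigr => p _;
  by rewrite mulr_sumr; apply: eq_bigr => q _; rewrite -mulrA.
Qed.

Lemma rttMl rho X Y a b c d k : central k ->
  rtt rho (fun a b => k * X a b) Y a b c d = k * rtt rho X Y a b c d.
Proof.
move=> ck; rewrite /rtt mulrBr !mulr_sumr; congr (_ - _); apply: eq_bigr => p _;
  rewrite mulr_sumr; apply: eq_bigr => q _.
  by rewrite -[k * X p b * _]mulrA [RHS]mulrA (ck (rho _ _ _ _)) -mulrA.
by rewrite [Y c q * _]mulrA -(ck (Y c q)) -[k * _ * _]mulrA [RHS]mulrA (ck (rho _ _ _ _)) -mulrA.
Qed.

Lemma rttMr rho X Y a b c d k : central k ->
  rtt rho X (fun a b => k * Y a b) a b c d = k * rtt rho X Y a b c d.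
Proof.
move=> ck; rewrite /rtt mulrBr !mulr_sumr; congr (_ - _); apply: eq_bigr => p _;
  rewrite mulr_sumr; apply: eq_bigr => q _.
  by rewrite [X p b * _]mulrA -(ck (X p b)) -[k * _ * _]mulrA [RHS]mulrA (ck (rho _ _ _ _)) -mulrA.
by rewrite -[k * Y c q * _]mulrA [RHS]mulrA (ck (rho _ _ _ _)) -mulrA.
Qed.

Lemma rtt_linear rho0 rho1 X0 X1 Y0 Y1 m0 m1 k0 k1 l0 l1 a b c d :
  central k0 -> central k1 -> central l0 -> central l1 ->
  rtt (fun a c b d => m0 * rho0 a c b d + m1 * rho1 a c b d)
      (fun a b => k0 * X0 a b + k1 * X1 a b) (fun a b => l0 * Y0 a b + l1 * Y1 a b) a b c d =
  m0 * (k0 * (l0 * rtt rho0 X0 Y0 a b c d + l1 * rtt rho0 X0 Y1 a b c d) +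
        k1 * (l0 * rtt rho0 X1 Y0 a b c d + l1 * rtt rho0 X1 Y1 a b c d)) +
  m1 * (k0 * (l0 * rtt rho1 X0 Y0 a b c d + l1 * rtt rho1 X0 Y1 a b c d) +
        k1 * (l0 * rtt rho1 X1 Y0 a b c d + l1 * rtt rho1 X1 Y1 a b c d)).
Proof.
move=> ck0 ck1 cl0 cl1.
by rewrite rttDrho !rttMrho !rttDl !(rttMl _ _ _ _ _ _ _ ck0) !(rttMl _ _ _ _ _ _ _ ck1)
  !rttDr !(rttMr _ _ _ _ _ _ _ cl0) !(rttMr _ _ _ _ _ _ _ cl1).
Qed.

Definition entry_mul X Y a b : S := \sum_(e < N) X a e * Y e b.
Definition entry_one a b : S := if a == b then 1 else 0.

Lemma rtt_one rho a b c d : rtt rho entry_one entry_one a b c d = 0.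
Proof.
have sum1 F (i : 'I_N) : \sum_p (F p * entry_one p i : S) = F i.
  rewrite (bigD1 i) //= /entry_one eqxx mulr1 big1 ?addr0 // => p /negPf->.
  by rewrite mulr0.
apply/eqP; rewrite subr_eq0; apply/eqP; transitivity (rho a c b d).
  under eq_bigr => p _. under eq_bigr => q _ do rewrite mulrA.
  rewrite sum1. over. exact: sum1.
apply/esym; rewrite -[RHS](sum1 (fun p => rho p c b d)); apply: eq_bigr => p _.
rewrite -[in RHS](sum1 (fun q => rho p q b d)) mulr_suml; apply: eq_bigr => q _.
by rewrite mulrA /entry_one ![_ == a]eq_sym ![_ == c]eq_sym.
Qed.

(** The usual coproduct argument: since X' commutes with Y, R X_1 X'_1 Y_2 Y'_2 equals (R X_1 Y_2)
    X'_1 Y'_2, so R passes one pair at a time; at the end X is moved across Y'. *)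
Lemma rtt_mul rho X Y X' Y' :
  (forall a c b d, central (rho a c b d)) ->
  (forall a b c d, X' a b * Y c d = Y c d * X' a b) ->
  (forall a b c d, X a b * Y' c d = Y' c d * X a b) ->
  (forall a b c d, rtt rho X Y a b c d = 0) ->
  (forall a b c d, rtt rho X' Y' a b c d = 0) ->
  forall a b c d, rtt rho (entry_mul X X') (entry_mul Y Y') a b c d = 0.
Proof.
move=> cr c1 c2 r1 r2 a b c d; apply/eqP; rewrite subr_eq0; apply/eqP.
have E1 a' b' c' d' := subr0_eq (r1 a' b' c' d').
have E2 a' b' c' d' := subr0_eq (r2 a' b' c' d').
transitivity (\sum_e \sum_f (\sum_p \sum_q rho a c p q * (X p e * Y q f)) * (X' e b * Y' f d)).
  transitivity (\sum_p \sum_q \sum_e \sum_f (rho a c p q * (X p e * Y q f)) * (X' e b * Y' f d)).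
    apply: eq_bigr => p _; apply: eq_bigr => q _; rewrite mulr_suml mulr_sumr.
    apply: eq_bigr => e _; rewrite mulr_sumr mulr_sumr; apply: eq_bigr => f _.
    by rewrite -!mulrA; congr (_ * (_ * _)); rewrite !mulrA c1.
  transitivity (\sum_p \sum_e \sum_f \sum_q (rho a c p q * (X p e * Y q f)) * (X' e b * Y' f d)).
    apply: eq_bigr => p _; rewrite exchange_big; apply: eq_bigr => e _; exact: exchange_big.
  rewrite exchange_big; apply: eq_bigr => e _; rewrite exchange_big; apply: eq_bigr => f _.
  by rewrite mulr_suml; apply: eq_bigr => p _; rewrite mulr_suml.
transitivity (\sum_e \sum_f (\sum_p \sum_q rho p q e f * (Y c q * X a p)) * (X' e b * Y' f d)).
  by apply: eq_bigr => e _; apply: eq_bigr => f _; rewrite E1.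
transitivity (\sum_p \sum_q (Y c q * X a p) * (\sum_e \sum_f rho p q e f * (X' e b * Y' f d))).
  transitivity (\sum_e \sum_f \sum_p \sum_q (Y c q * X a p) * (rho p q e f * (X' e b * Y' f d))).
    apply: eq_bigr => e _; apply: eq_bigr => f _; rewrite mulr_suml.
    apply: eq_bigr => p _; rewrite mulr_suml; apply: eq_bigr => q _.
    by rewrite cr -!mulrA.
  transitivity (\sum_e \sum_p \sum_q \sum_f (Y c q * X a p) * (rho p q e f * (X' e b * Y' f d))).
    apply: eq_bigr => e _; rewrite exchange_big; apply: eq_bigr => p _; exact: exchange_big.
  rewrite exchange_big; apply: eq_bigr => p _; rewrite exchange_big; apply: eq_bigr => q _.
  by rewrite mulr_sumr; apply: eq_bigr => e _; rewrite mulr_sumr.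
transitivity (\sum_p \sum_q (Y c q * X a p) * (\sum_e \sum_f rho e f b d * (Y' q f * X' p e))).
  by apply: eq_bigr => p _; apply: eq_bigr => q _; rewrite E2.
transitivity (\sum_e \sum_f \sum_p \sum_q (Y c q * X a p) * (rho e f b d * (Y' q f * X' p e))).
  transitivity (\sum_p \sum_e \sum_f \sum_q (Y c q * X a p) * (rho e f b d * (Y' q f * X' p e))).
    apply: eq_bigr => p _.
    transitivity (\sum_q \sum_e \sum_f
        (Y c q * X a p) * (rho e f b d * (Y' q f * X' p e))).
      by apply: eq_bigr => q _; rewrite mulr_sumr; apply: eq_bigr => e _; rewrite mulr_sumr.
    by rewrite exchange_big; apply: eq_bigr => e _; rewrite exchange_big.
  by rewrite exchange_big; apply: eq_bigr => e _; rewrite exchange_big.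
apply: eq_bigr => e _; apply: eq_bigr => f _; rewrite mulr_suml mulr_sumr exchange_big.
apply: eq_bigr => q _; rewrite mulr_sumr mulr_sumr; apply: eq_bigr => p _.
rewrite mulrA -cr -!mulrA; congr (_ * (_ * _)); rewrite !mulrA; congr (_ * _).
exact: c2.
Qed.

End RTT.

Lemma rtt_morph N (S T : nzRingType) (f : {rmorphism S -> T}) rho X Y a b c d :
  rtt (N := N) (fun a c b d => f (rho a c b d)) (fun a b => f (X a b)) (fun a b => f (Y a b)) a b c d =
  f (rtt rho X Y a b c d).
Proof.
rewrite /rtt rmorphB !rmorph_sum; congr (_ - _); apply: eq_bigr => p _; rewrite rmorph_sum;
  by apply: eq_bigr => q _; rewrite !rmorphM.
Qed.

(** * Weighted shift operators on one lattice *)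

Section SiteOperators.
Variable N : nat.
Implicit Types (i j : nat) (a b c d : 'I_N) (s : site N).

Definition site_shift i a b s : site N := fun j => if j == i then sh1 a b (s j) else s j.

Lemma site_op_linear i a b (phi : ('I_N -> int) -> Laurent) :
  state_linear (fun (u : state N) s => phi (s i) * u (site_shift i a b s)).
Proof. by move=> c u v s; rewrite mulrDr mulrCA. Qed.

Definition site_op i a b phi : endo N := Endo (site_op_linear i a b phi).

Lemma sh1C a b c d nu : sh1 a b (sh1 c d nu) = sh1 c d (sh1 a b nu).
Proof. by apply/funext => l; rewrite /sh1; ring. Qed.

Lemma sh1_exch a b c d nu : sh1 a b (sh1 c d nu) = sh1 a d (sh1 c b nu).
Proof. by apply/funext => l; rewrite /sh1; ring. Qed.

Lemma site_shift_same i a b s : site_shift i a b s i = sh1 a b (s i).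
Proof. by rewrite /site_shift eqxx. Qed.

Lemma site_shiftC i a b j c d s :
  site_shift i a b (site_shift j c d s) = site_shift j c d (site_shift i a b s).
Proof.
apply/funext => k; rewrite /site_shift.
by case: eqP => [->|] //; case: eqP => [->|] //; rewrite sh1C.
Qed.

Lemma site_shift_exch i a b c d s :
  site_shift i a b (site_shift i c d s) = site_shift i a d (site_shift i c b s).
Proof. by apply/funext => k; rewrite /site_shift; case: eqP => // _; rewrite sh1_exch. Qed.

Lemma site_op_comm i j a b c d phi psi : i != j ->
  site_op i a b phi * site_op j c d psi = site_op j c d psi * site_op i a b phi.
Proof.
move=> ij; apply: endoP => u s /=.
by rewrite [in LHS]site_shiftC /site_shift eq_sym !(negPf ij) mulrCA.
Qed.

Lemma rtt_site i (X Y : 'I_N -> 'I_N -> ('I_N -> int) -> Laurent) a b c d u s :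
  rtt (fun a c b d => (Ru a c b d)%:A) (fun a b => site_op i a b (X a b))
      (fun a b => site_op i a b (Y a b)) a b c d u s =
  kplus X Y a b c d (s i) * u (site_shift i a b (site_shift i c d s)) /\
  rtt (fun a c b d => (Rv a c b d)%:A) (fun a b => site_op i a b (X a b))
      (fun a b => site_op i a b (Y a b)) a b c d u s =
  kminus X Y a b c d (s i) * u (site_shift i a b (site_shift i c d s)).
Proof.
have alg (r : Laurent) (f : endo N) : r%:A * f = r *: f by rewrite mulr_algl.
have sumE (F : 'I_N -> 'I_N -> 'I_N -> 'I_N -> Laurent) (G : 'I_N -> 'I_N -> endo N) :
  \sum_p \sum_q (F a c p q)%:A * G p q = \sum_p \sum_q F a c p q *: G p q.
  by apply: eq_bigr => p _; apply: eq_bigr => q _; rewrite alg.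
have sumE' (F : 'I_N -> 'I_N -> 'I_N -> 'I_N -> Laurent) (G : 'I_N -> 'I_N -> endo N) :
  \sum_p \sum_q (F p q b d)%:A * G p q = \sum_p \sum_q F p q b d *: G p q.
  by apply: eq_bigr => p _; apply: eq_bigr => q _; rewrite alg.
rewrite /rtt (sumE (@Ru N)) (sumE' (@Ru N)) (sumE (@Rv N)) (sumE' (@Rv N)) sum_Ru sum_Ru' sum_Rv sum_Rv'.
have e1 : site_shift i c d (site_shift i a b s) = site_shift i a b (site_shift i c d s) by rewrite site_shiftC.
have e2 : site_shift i a d (site_shift i c b s) = site_shift i a b (site_shift i c d s) by rewrite site_shift_exch.
have e3 : site_shift i c b (site_shift i a d s) = site_shift i a b (site_shift i c d s).
  by rewrite site_shiftC site_shift_exch.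
split; rewrite /= /kplus /kminus /kmul !site_shift_same e1 ?e2 ?e3; ring.
Qed.

Variables (kap kap' : 'I_N -> Laurent) (al be : 'I_N -> int -> Laurent).
Hypothesis al_be : forall l n, al l n * be l (n - 1) = kap l * zp n - kap' l * zp (- n).
Variable i : nat.

Definition Elow a b := site_op i a b (Mlow kap al be a b).
Definition Eupp a b := site_op i a b (Mupp kap' al be a b).

Let RU a c b d : endo N := (Ru a c b d)%:A.
Let RV a c b d : endo N := (Rv a c b d)%:A.

Lemma rtt_Elow_Elow a b c d :
  rtt RU Elow Elow a b c d = 0 /\ rtt RV Elow Elow a b c d = 0.
Proof.
split; apply: endoP => u s.
  have [-> _] := rtt_site i (Mlow kap al be) (Mlow kap al be) a b c d u s.
  by rewrite (kernel_low_low al_be) mul0r.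
have [_ ->] := rtt_site i (Mlow kap al be) (Mlow kap al be) a b c d u s.
by rewrite kminus_same (kernel_low_low al_be) oppr0 mul0r.
Qed.

Lemma rtt_Eupp_Eupp a b c d :
  rtt RU Eupp Eupp a b c d = 0 /\ rtt RV Eupp Eupp a b c d = 0.
Proof.
split; apply: endoP => u s.
  have [-> _] := rtt_site i (Mupp kap' al be) (Mupp kap' al be) a b c d u s.
  by rewrite (kernel_upp_upp al_be) mul0r.
have [_ ->] := rtt_site i (Mupp kap' al be) (Mupp kap' al be) a b c d u s.
by rewrite kminus_same (kernel_upp_upp al_be) oppr0 mul0r.
Qed.

Lemma rtt_Elow_Eupp a b c d : rtt RU Elow Eupp a b c d = 0.
Proof.
apply: endoP => u s.
have [-> _] := rtt_site i (Mlow kap al be) (Mupp kap' al be) a b c d u s.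
by rewrite (kernel_low_upp al_be) mul0r.
Qed.

Lemma rtt_Eupp_Elow a b c d : rtt RV Eupp Elow a b c d = 0.
Proof.
apply: endoP => u s.
have [_ ->] := rtt_site i (Mupp kap' al be) (Mlow kap al be) a b c d u s.
by rewrite (kernel_upp_low al_be) mul0r.
Qed.

Lemma rtt_mixed a b c d : rtt RU Eupp Elow a b c d = - rtt RV Elow Eupp a b c d.
Proof.
apply: endoP => u s.
have [E _] := rtt_site i (Mupp kap' al be) (Mlow kap al be) a b c d u s.
have [_ E'] := rtt_site i (Mlow kap al be) (Mupp kap' al be) a b c d u s.
have -> : (- rtt RV Elow Eupp a b c d) u s = - rtt RV Elow Eupp a b c d u s by [].
rewrite E E' -mulNr; congr (_ * _); apply/eqP.
by rewrite -addr_eq0 (kernel_mixed al_be).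
Qed.
End SiteOperators.

(** * Polynomial solutions of the RTT relation and their products *)

(** [series0] and [series1] stand for u and 1 when the variable of the series is u. When it is u^-1,
    both are multiplied by u^-1 and become 1 and u^-1. *)
Definition series0 (R : nzRingType) (bar : bool) : {poly R} := if bar then 'X else 1.
Definition series1 (R : nzRingType) (bar : bool) : {poly R} := if bar then 1 else 'X.

Section PolynomialSeries.
Variables (N : nat) (A : algType Laurent).
Variable P : bool -> 'I_N -> 'I_N -> {poly A}.
Implicit Types (a b c d : 'I_N) (m n : int).

Definition poly_gen (x : gen N) : A := (P (gbar x) (grow x) (gcol x))`_(gdeg x).

Local Notation S := {poly {poly A}}.
(** The outer variable of [S] belongs to the first tensor factor and the inner variable to the
    second. *)
Definition lift1 (p : {poly A}) : S := map_poly polyC p.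
Definition lift2 (p : {poly A}) : S := p%:P.
Definition lift12 (x : A) : S := x%:P%:P.

Definition U0 bx : S := series0 _ bx.
Definition U1 bx : S := series1 _ bx.
Definition V0 bx : S := (series0 A bx)%:P.
Definition V1 bx : S := (series1 A bx)%:P.

Lemma centralX (R : nzRingType) : central ('X : {poly R}).
Proof. by move=> p; rewrite commr_polyX. Qed.

Lemma centralC (R : nzRingType) (k : R) : central k -> central (k%:P : {poly R}).
Proof. by move=> ck p; apply/polyP => i; rewrite coefCM coefMC ck. Qed.

Lemma central_alg (r : Laurent) : central (r%:A : A).
Proof. by move=> x; rewrite mulr_algl mulr_algr. Qed.

Lemma central_lift12 (r : Laurent) : central (lift12 r%:A).
Proof. exact/centralC/centralC/central_alg. Qed.

Lemma central_U0 bx : central (U0 bx).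
Proof. by case: bx; [apply: centralX | apply: central1]. Qed.
Lemma central_U1 bx : central (U1 bx).
Proof. by case: bx; [apply: central1 | apply: centralX]. Qed.
Lemma central_V0 bx : central (V0 bx).
Proof. by apply: centralC; case: bx; [apply: centralX | apply: central1]. Qed.
Lemma central_V1 bx : central (V1 bx).
Proof. by apply: centralC; case: bx; [apply: central1 | apply: centralX]. Qed.

(* The R-matrix, homogenized so that it has polynomial coefficients in either
   the spectral parameter or its inverse. *)
Definition rtt_matrix bx by_ a c b d : S :=
  (U0 bx * V1 by_) * lift12 (Ru a c b d)%:A + (U1 bx * V0 by_) * lift12 (Rv a c b d)%:A.

(** The shift by 1 accounts for the multiplication by u^-1: the coefficient of u^m becomes that of
    (u^-1)^(1 - m). *)
Definition series_index (bx : bool) m : int := if bx then m else 1 - m.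

Lemma ser_series0 bx a b m :
  ser_coef poly_gen bx a b (m - 1) =
  if 0 <= series_index bx m then (series0 A bx * P bx a b)`_`|series_index bx m|%N else 0.
Proof.
rewrite /ser_coef /poly_gen /series_index /series0 /=; case: bx.
  rewrite coefXM; case: ifP => m1; case: ifP => m0 //; first 1 last.
  - by lia.
  - by rewrite ifT //; lia.
  by case: eqP => [|_]; [lia | congr (_`_ _); lia].
rewrite mul1r subr_ge0 subr_le0; case: ifP => // m1.
by congr (_`_ _); lia.
Qed.

Lemma ser_series1 bx a b m :
  ser_coef poly_gen bx a b m =
  if 0 <= series_index bx m then (series1 A bx * P bx a b)`_`|series_index bx m|%N else 0.
Proof.
rewrite /ser_coef /poly_gen /series_index /series1 /=; case: bx; first by rewrite mul1r.
rewrite coefXM; case: ifP => m1; case: ifP => m0 //; first 1 last.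
- by lia.
- by rewrite ifT //; lia.
by case: eqP => [|_]; [lia | congr (_`_ _); lia].
Qed.

Lemma lift1M p q : lift1 (p * q) = lift1 p * lift1 q.
Proof. exact: rmorphM. Qed.

Lemma coef_lift12 (p q : {poly A}) i j : (lift1 p * lift2 q)`_i`_j = p`_i * q`_j.
Proof. by rewrite coefMC coef_map /= coefCM. Qed.
Lemma coef_lift21 (p q : {poly A}) i j : (lift2 q * lift1 p)`_i`_j = q`_j * p`_i.
Proof. by rewrite coefCM coef_map /= coefMC. Qed.
Lemma coef_lift (r : Laurent) (p : S) i j : (lift12 r%:A * p)`_i`_j = r *: p`_i`_j.
Proof. by rewrite !coefCM mulr_algl. Qed.

Lemma lift1_series0 bx (p : {poly A}) : U0 bx * lift1 p = lift1 (series0 A bx * p).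
Proof. by rewrite lift1M /U0 /series0; case: bx; rewrite /lift1 ?map_polyX ?rmorph1. Qed.
Lemma lift1_series1 bx (p : {poly A}) : U1 bx * lift1 p = lift1 (series1 A bx * p).
Proof. by rewrite lift1M /U1 /series1; case: bx; rewrite /lift1 ?map_polyX ?rmorph1. Qed.
Lemma lift2_series0 bx (p : {poly A}) : V0 bx * lift2 p = lift2 (series0 A bx * p).
Proof. by rewrite /lift2 polyCM. Qed.
Lemma lift2_series1 bx (p : {poly A}) : V1 bx * lift2 p = lift2 (series1 A bx * p).
Proof. by rewrite /lift2 polyCM. Qed.

Lemma central_shuffle (T : nzRingType) (u v r x y : T) : central u -> central v ->
  (u * v) * r * (x * y) = r * ((u * x) * (v * y)) /\
  (u * v) * r * (y * x) = r * ((v * y) * (u * x)).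
Proof.
move=> cu cv; have cuv := centralM cu cv; split; rewrite cuv -mulrA; congr (_ * _).
  by rewrite -!mulrA; congr (_ * _); rewrite !mulrA cv.
by rewrite cu -!mulrA; congr (_ * _); rewrite [in RHS]mulrA -cu !mulrA.
Qed.

Lemma rtt_coef_poly bx by_ a c b d m n :
  rtt_coef poly_gen bx by_ a c b d m n =
  if (0 <= series_index bx m) && (0 <= series_index by_ n) then
   (rtt (rtt_matrix bx by_) (fun a b => lift1 (P bx a b)) (fun a b => lift2 (P by_ a b)) a b c d)
     `_(`|series_index bx m|%N)`_(`|series_index by_ n|%N)
  else 0.
Proof.
have sm a' b' := ser_series1 bx a' b' m; have sm1 a' b' := ser_series0 bx a' b' m.
have sn a' b' := ser_series1 by_ a' b' n; have sn1 a' b' := ser_series0 by_ a' b' n.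
rewrite /rtt_coef; case: ifP => [/andP[m0 n0]|mn0]; last first.
  by rewrite !big1 ?subrr // => p _; rewrite big1 // => q _;
    rewrite sm sm1 sn sn1; case/nandP: (negbT mn0) => /negbTE->;
    rewrite ?mul0r ?mulr0 !scaler0 addr0.
rewrite /rtt !coefB !coef_sum; congr (_ - _); apply: eq_bigr => p _;
  rewrite !coef_sum; apply: eq_bigr => q _; rewrite /rtt_matrix mulrDl !coefD;
  rewrite sm sm1 sn sn1 m0 n0; congr (_ + _).
- have [-> _] := central_shuffle (lift12 (Ru a c p q)%:A) (lift1 (P bx p b)) (lift2 (P by_ q d))
    (@central_U0 bx) (@central_V1 by_).
  by rewrite lift1_series0 lift2_series1 coef_lift coef_lift12.
- have [-> _] := central_shuffle (lift12 (Rv a c p q)%:A) (lift1 (P bx p b)) (lift2 (P by_ q d))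
    (@central_U1 bx) (@central_V0 by_).
  by rewrite lift1_series1 lift2_series0 coef_lift coef_lift12.
- have [_ ->] := central_shuffle (lift12 (Ru p q b d)%:A) (lift1 (P bx a p)) (lift2 (P by_ c q))
    (@central_U0 bx) (@central_V1 by_).
  by rewrite lift1_series0 lift2_series1 coef_lift coef_lift21.
have [_ ->] := central_shuffle (lift12 (Rv p q b d)%:A) (lift1 (P bx a p)) (lift2 (P by_ c q))
    (@central_U1 bx) (@central_V0 by_).
by rewrite lift1_series1 lift2_series0 coef_lift coef_lift21.
Qed.

End PolynomialSeries.

Record block (N : nat) := Block {
  kap : 'I_N -> Laurent; kap' : 'I_N -> Laurent;
  al : 'I_N -> int -> Laurent; be : 'I_N -> int -> Laurent;
  spec : Laurent; spec' : Laurent;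
  al_be : forall l n, al l n * be l (n - 1) = kap l * zp n - kap' l * zp (- n);
  kapK : forall l, kap l * kap' l = 1;
  specK : spec * spec' = 1 }.

Section BlockProduct.
Variables (N : nat) (B : nat -> block N).
Implicit Types (i : nat) (a b c d : 'I_N) (bar : bool).

Local Notation E := (endo N).
Local Notation low i := (Elow (kap (B i)) (al (B i)) (be (B i)) i).
Local Notation upp i := (Eupp (kap' (B i)) (al (B i)) (be (B i)) i).

(** One matrix expanded at infinity and at zero: multiplying the unbarred series by the scalar
    -[spec'] u gives the barred one. The normalizations make the terms of degree 0 triangular, with
    inverse diagonals. *)
Definition blockP i bar a b : {poly E} :=
  if bar then (upp i a b)%:P - 'X * (spec' (B i) *: low i a b)%:P
  else (low i a b)%:P - 'X * (spec (B i) *: upp i a b)%:P.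

Fixpoint prodP m bar : 'I_N -> 'I_N -> {poly E} :=
  if m is i.+1 then entry_mul (prodP i bar) (blockP i bar) else @entry_one N {poly E}.

Definition k0 i bar : {poly E} := if bar then - ((spec' (B i))%:A)%:P * 'X else 1.
Definition k1 i bar : {poly E} := if bar then 1 else - ((spec (B i))%:A)%:P * 'X.

Lemma blockP_lin i bar a b :
  blockP i bar a b = k0 i bar * (low i a b)%:P + k1 i bar * (upp i a b)%:P.
Proof.
have e (r : Laurent) (x : E) : 'X * (r *: x)%:P = ((r%:A)%:P : {poly E}) * 'X * x%:P.
  by rewrite -mulrA -!commr_polyX mulrA -polyCM mulr_algl.
rewrite /blockP /k0 /k1; case: bar; rewrite e !mulNr mul1r //.
by rewrite addrC.
Qed.

Lemma lift1_k0 i bar :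
  lift1 (k0 i bar) = if bar then - lift12 (spec' (B i))%:A * 'X else 1.
Proof.
rewrite /lift1 /k0; case: bar; last exact: rmorph1.
by rewrite rmorphM rmorphN /= map_polyC map_polyX.
Qed.

Lemma lift1_k1 i bar :
  lift1 (k1 i bar) = if bar then 1 else - lift12 (spec (B i))%:A * 'X.
Proof.
rewrite /lift1 /k1; case: bar; first exact: rmorph1.
by rewrite rmorphM rmorphN /= map_polyC map_polyX.
Qed.

Lemma lift2_k0 i bar :
  lift2 (k0 i bar) = if bar then - lift12 (spec' (B i))%:A * 'X%:P else 1.
Proof. by rewrite /lift2 /k0; case: bar => //; rewrite polyCM polyCN. Qed.

Lemma lift2_k1 i bar :
  lift2 (k1 i bar) = if bar then 1 else - lift12 (spec (B i))%:A * 'X%:P.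
Proof. by rewrite /lift2 /k1; case: bar => //; rewrite polyCM polyCN. Qed.

Lemma centralN (T : nzRingType) (k : T) : central k -> central (- k).
Proof. by move=> ck x; rewrite mulNr mulrN ck. Qed.

Lemma central_if (T : nzRingType) (t : bool) (x y : T) :
  central x -> central y -> central (if t then x else y).
Proof. by case: t. Qed.

Lemma central_lift_k i bar :
  [/\ central (lift1 (k0 i bar)), central (lift1 (k1 i bar)),
      central (lift2 (k0 i bar)) & central (lift2 (k1 i bar))].
Proof.
have cX r : central (- lift12 (r%:A : E) * 'X).
  exact/centralM/centralX/centralN/central_lift12.
have cY r : central (- lift12 (r%:A : E) * 'X%:P).
  exact/centralM/centralC/centralX/centralN/central_lift12.
have c1 := @central1 {poly {poly E}}.
by split; rewrite ?lift1_k0 ?lift1_k1 ?lift2_k0 ?lift2_k1; apply: central_if.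
Qed.

(** For the two mixed products of lower and upper parts only the sum of the R-terms at u and at v
    vanishes, so their scalar prefactors must agree. This is where [spec'] has to be the inverse of
    [spec]. *)
Lemma lift_k_exchange i bx by_ :
  U0 E bx * V1 E by_ * (lift1 (k1 i bx) * lift2 (k0 i by_)) =
  U1 E bx * V0 E by_ * (lift1 (k0 i bx) * lift2 (k1 i by_)).
Proof.
have cK : lift12 (spec (B i))%:A * lift12 (spec' (B i))%:A = 1 :> {poly {poly E}}.
  by rewrite -!polyCM mulr_algl scalerA specK scale1r.
have ck r := @central_lift12 E r.
have cX : central ('X : {poly {poly E}}) by apply: centralX.
rewrite lift1_k0 lift1_k1 lift2_k0 lift2_k1 /U0 /U1 /V0 /V1 /series0 /series1.
set K := lift12 _ in cK *; set K' := lift12 _ in cK *.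
have [cK1 cK2] : central K /\ central K' by split; apply: ck.

have cA (k x y : {poly {poly E}}) : central k -> x * (k * y) = k * (x * y).
  by move=> ck'; rewrite mulrA -ck' mulrA.
have cK' : K' * K = 1 by rewrite -cK1.
clearbody K K'.
case: bx; case: by_; rewrite ?mul1r ?mulr1 ?polyC1 ?mulr1 ?mul1r !mulNr ?mulrN ?opprK.
- by rewrite !(cA K') // cX.
- by rewrite -[K' * _ * _]mulrA (cA K) // [K' * _]mulrA cK' mul1r.
- by rewrite -[K * _ * _]mulrA (cA K') // [K * _]mulrA cK mul1r.
by rewrite !(cA K) // cX.
Qed.

HB.instance Definition _ := GRing.RMorphism.copy (@lift12 E) (polyC \o polyC).

Lemma expand_mixed (T : nzRingType) (m0 m1 h0 h1 l0 l1 r : T) :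
  m0 * (h1 * l0) = m1 * (h0 * l1) ->
  m0 * (h0 * (l0 * 0 + l1 * 0) + h1 * (l0 * - r + l1 * 0)) +
  m1 * (h0 * (l0 * 0 + l1 * r) + h1 * (l0 * 0 + l1 * 0)) = 0.
Proof.
move=> e; rewrite !mulr0 !addr0 !add0r !mulr0 addr0 add0r !mulrN !mulrA.
by rewrite -!(mulrA _ h1) -!(mulrA _ h0) e addNr.
Qed.

Lemma rtt_block i bx by_ a b c d :
  rtt (rtt_matrix E bx by_) (fun a b => lift1 (blockP i bx a b))
     (fun a b => lift2 (blockP i by_ a b)) a b c d = 0.
Proof.
have el1 : (fun a b => lift1 (blockP i bx a b)) =
    (fun a b => lift1 (k0 i bx) * lift12 (low i a b) + lift1 (k1 i bx) * lift12 (upp i a b)).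
  apply/funext => a'; apply/funext => b'.
  by rewrite blockP_lin /lift1 rmorphD !rmorphM /= !map_polyC.
have el2 : (fun a b => lift2 (blockP i by_ a b)) =
    (fun a b => lift2 (k0 i by_) * lift12 (low i a b) + lift2 (k1 i by_) * lift12 (upp i a b)).
  apply/funext => a'; apply/funext => b'.
  by rewrite blockP_lin /lift2 polyCD !polyCM.
have [c10 c11 _ _] := central_lift_k i bx; have [_ _ c20 c21] := central_lift_k i by_.
rewrite el1 el2 rtt_linear //.
have L (rho : 'I_N -> 'I_N -> 'I_N -> 'I_N -> E) X Y :
  rtt (fun a c b d => lift12 (rho a c b d)) (fun a b => lift12 (X a b)) (fun a b => lift12 (Y a b)) a b c d =
  lift12 (rtt rho X Y a b c d) by exact: (rtt_morph (@lift12 E)).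
have L0 : lift12 0 = 0 :> {poly {poly E}} by rewrite /lift12 !polyC0.
have LN x : lift12 (- x) = - lift12 x :> {poly {poly E}} by rewrite /lift12 !polyCN.
rewrite !L; have [-> ->] := rtt_Elow_Elow (al_be (B i)) i a b c d.
have [-> ->] := rtt_Eupp_Eupp (al_be (B i)) i a b c d.
rewrite (rtt_Elow_Eupp (al_be (B i))) (rtt_Eupp_Elow (al_be (B i))).
rewrite (rtt_mixed (al_be (B i))) L0 LN.
exact/expand_mixed/lift_k_exchange.
Qed.

Definition comm_from m (f : E) := forall i a b phi, (m <= i)%N ->
  f * site_op i a b phi = site_op i a b phi * f.

Lemma comm_fromD m f h : comm_from m f -> comm_from m h -> comm_from m (f + h).
Proof. by move=> cf ch i a b phi im; rewrite mulrDl mulrDr cf // ch. Qed.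

Lemma comm_from0 m : comm_from m 0.
Proof. by move=> i a b phi _; rewrite mul0r mulr0. Qed.

Lemma comm_from_sum m (I : Type) (r : seq I) (P : pred I) (F : I -> E) :
  (forall x, comm_from m (F x)) -> comm_from m (\sum_(x <- r | P x) F x).
Proof.
by move=> cF; elim/big_ind: _ => //; [apply: comm_from0 | move=> ? ?; apply: comm_fromD].
Qed.

Lemma comm_fromM m f h : comm_from m f -> comm_from m h -> comm_from m (f * h).
Proof. by move=> cf ch i a b phi im; rewrite -mulrA ch // mulrA cf // mulrA. Qed.

Lemma comm_fromZ m r f : comm_from m f -> comm_from m (r *: f).
Proof. by move=> cf i a b phi im; rewrite -scalerAl cf // scalerAr. Qed.

Lemma blockP_coef i bar a b r :
  (blockP i bar a b)`_r = (if r == 0 then if bar then upp i a b else low i a b else 0) -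
   (if r == 1 then if bar then spec' (B i) *: low i a b else spec (B i) *: upp i a b else 0).
Proof.
rewrite /blockP; case: bar; rewrite coefB coefXM !coefC;
  by case: r => [|[|r]]; rewrite ?subr0.
Qed.

Lemma blockP_comm m f bar a b r : comm_from m f ->
  f * (blockP m bar a b)`_r = (blockP m bar a b)`_r * f.
Proof.
move=> cf; rewrite blockP_coef mulrBr mulrBl; congr (_ - _).
  by case: eqP; rewrite ?mulr0 ?mul0r //; case: bar => _; apply: cf.
by case: eqP; rewrite ?mulr0 ?mul0r //; case: bar => _; rewrite -scalerAr -scalerAl cf.
Qed.

Lemma comm_from_site i m a b phi : (i < m)%N -> comm_from m (site_op i a b phi).
Proof.
move=> im j c d psi mj; apply: site_op_comm.
by rewrite neq_ltn (leq_trans im mj).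
Qed.

Lemma prodP_comm m bar a b r : comm_from m (prodP m bar a b)`_r.
Proof.
elim: m a b r => [|m IH] a b r.
  rewrite /= /entry_one; case: eqP => _; last by rewrite coef0; apply: comm_from0.
  by rewrite coef1 => i c d phi _; case: eqP; rewrite ?mul1r ?mulr1 ?mul0r ?mulr0.
rewrite /= /entry_mul coef_sum; apply: comm_from_sum => e.
rewrite coefM; apply: comm_from_sum => k; apply: comm_fromM.
  by move=> i c d phi im; apply: IH; apply: ltnW.
rewrite blockP_coef -scaleN1r; apply: comm_fromD.
  case: eqP => _; last exact: comm_from0.
  by case: bar {IH}; apply: comm_from_site.
apply: comm_fromZ; case: eqP => _; last exact: comm_from0.
by case: bar {IH}; apply: comm_fromZ; apply: comm_from_site.
Qed.

Lemma lift_comm (p q : {poly E}) : (forall i j, p`_i * q`_j = q`_j * p`_i) ->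
  lift1 p * lift2 q = lift2 q * lift1 p.
Proof.
by move=> c; apply/polyP => i; apply/polyP => j; rewrite coef_lift12 coef_lift21.
Qed.

Lemma rtt_prodP m bx by_ a b c d :
  rtt (rtt_matrix E bx by_) (fun a b => lift1 (prodP m bx a b))
     (fun a b => lift2 (prodP m by_ a b)) a b c d = 0.
Proof.
elim: m a b c d => [|m IH] a b c d.
  have e1 : (fun a b => lift1 (prodP 0 bx a b)) = @entry_one N _.
    apply/funext => a'; apply/funext => b'; rewrite /= /entry_one /lift1.
    by case: eqP; rewrite ?rmorph1 ?rmorph0.
  have e2 : (fun a b => lift2 (prodP 0 by_ a b)) = @entry_one N _.
    apply/funext => a'; apply/funext => b'; rewrite /= /entry_one /lift2.
    by case: eqP; rewrite ?polyC1 ?polyC0.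
  by rewrite e1 e2 rtt_one.
have e1 : (fun a b => lift1 (prodP m.+1 bx a b)) =
   entry_mul (fun a b => lift1 (prodP m bx a b)) (fun a b => lift1 (blockP m bx a b)).
  apply/funext => a'; apply/funext => b'; rewrite /= /entry_mul /lift1 rmorph_sum.
  by apply: eq_bigr => e _; rewrite rmorphM.
have e2 : (fun a b => lift2 (prodP m.+1 by_ a b)) =
   entry_mul (fun a b => lift2 (prodP m by_ a b)) (fun a b => lift2 (blockP m by_ a b)).
  apply/funext => a'; apply/funext => b'; rewrite /= /entry_mul /lift2 rmorph_sum.
  by apply: eq_bigr => e _; rewrite rmorphM.
rewrite e1 e2; apply: rtt_mul => //; first 1 last.
- move=> a' b' c' d'; apply: lift_comm => i j.
  by rewrite blockP_comm //; apply: prodP_comm.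
- move=> a' b' c' d'; apply: lift_comm => i j.
  by rewrite blockP_comm //; apply: prodP_comm.
- exact: rtt_block.
move=> a' c' b' d'; rewrite /rtt_matrix => x; rewrite mulrDl mulrDr; congr (_ + _).
  by apply/centralM/central_lift12/centralM; [apply: central_U0 | apply: central_V1].
by apply/centralM/central_lift12/centralM; [apply: central_U1 | apply: central_V0].
Qed.

Lemma blockP_tri i bar a b : (if bar then b < a else a < b)%N -> (blockP i bar a b)`_0 = 0.
Proof.
move=> ab; rewrite blockP_coef subr0 /=; apply: endoP => u s.
by case: bar ab => ab; rewrite /= /Mupp /Mlow (ltnNge, ltnW ab) ?(ltnNge b) ?(ltnW ab) /=
  ?(ltn_eqF ab) ?(gtn_eqF ab) mul0r.
Qed.

Lemma prodP_tri m bar a b : (if bar then b < a else a < b)%N -> (prodP m bar a b)`_0 = 0.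
Proof.
elim: m a b => [|m IH] a b ab.
  rewrite /= /entry_one; case: eqP ab => [->|_ _]; last by rewrite coef0.
  by rewrite ltnn; case: bar.
rewrite /= /entry_mul coef_sum big1 // => e _; rewrite coef0M.
have [ae|ae] := boolP (if bar then e < a else a < e)%N; first by rewrite IH ?mul0r.
rewrite blockP_tri ?mulr0 //.
by case: bar ab ae {IH} => ab; rewrite -leqNgt => ae; lia.
Qed.

Lemma prodP_diag m bar a : (prodP m.+1 bar a a)`_0 =
  (prodP m bar a a)`_0 * (if bar then upp m a a else low m a a).
Proof.
rewrite /= /entry_mul coef_sum (bigD1 a) //= big1 ?addr0; last first.
  move=> e ea; rewrite coef0M.
  have [ae|ae] := boolP (if bar then e < a else a < e)%N; first by rewrite prodP_tri ?mul0r.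
  rewrite blockP_tri ?mulr0 //; move: ea; rewrite -val_eqE /=.
  by case: bar ae; rewrite -leqNgt => ae; lia.
by rewrite coef0M blockP_coef subr0.
Qed.

Lemma low_uppK i a : low i a a * upp i a a = 1 /\ upp i a a * low i a a = 1.
Proof.
have shid nu : sh1 a a nu = nu by apply/funext => l; rewrite /sh1 subrK.
have sid s : site_shift i a a s = s.
  by apply/funext => k; rewrite /site_shift; case: eqP => // _; rewrite shid.
have K nu : (kap (B i) a * zp (nu a)) * (kap' (B i) a * zp (- nu a)) = 1.
  by rewrite mulrACA kapK zpNr mulr1.
split; apply: endoP => u s; rewrite /= /Mlow /Mupp ltnn eqxx !sid mulrA ?K ?mul1r //.
by rewrite [_ * (kap _ _ * _)]mulrC K mul1r.
Qed.

Lemma prodP_diagK m a :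
  (prodP m false a a)`_0 * (prodP m true a a)`_0 = 1 /\
  (prodP m true a a)`_0 * (prodP m false a a)`_0 = 1.
Proof.
elim: m => [|m [IH1 IH2]]; first by rewrite /= /entry_one eqxx coef1 mulr1.
have [K1 K2] := low_uppK m a; rewrite !prodP_diag.
have c bar : comm_from m (prodP m bar a a)`_0 by apply: prodP_comm.
split; rewrite -mulrA [X in _ * X]mulrA -c // -mulrA mulrA ?K1 ?K2 mulr1.
  by rewrite IH1.
by rewrite IH2.
Qed.

Lemma prodP_relations m : defining_relations (poly_gen (prodP m)).
Proof.
split.
- by move=> i j ij; apply: prodP_tri.
- by move=> i j ij; apply: (@prodP_tri m true).
- by move=> i; have [] := prodP_diagK m i.
- by move=> i; have [] := prodP_diagK m i.
by move=> a c b d k n; split; rewrite rtt_coef_poly; case: ifP => // _; rewrite rtt_prodP !coef0.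
Qed.
End BlockProduct.

(** * Reduction modulo z - 1 *)

Lemma poly_is_laurent (p : {poly CC}) : (tofrac p : Cz) \in is_laurent.
Proof. by apply/asboolP; exists p, 0%N; rewrite expr0 tofrac1 divr1. Qed.

Definition lpoly (p : {poly CC}) : Laurent := MkLaurent (poly_is_laurent p).

Lemma lpolyD : {morph lpoly : p q / p + q}.
Proof. by move=> p q; apply: val_inj; rewrite /= tofracD. Qed.
Lemma lpolyB : {morph lpoly : p q / p - q}.
Proof. by move=> p q; apply: val_inj; rewrite /= tofracB. Qed.
Lemma lpolyM : {morph lpoly : p q / p * q}.
Proof. by move=> p q; apply: val_inj; rewrite /= tofracM. Qed.
Lemma lpoly0 : lpoly 0 = 0.
Proof. by apply: val_inj; rewrite /= tofrac0. Qed.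
Lemma lpoly1 : lpoly 1 = 1.
Proof. by apply: val_inj; rewrite /= tofrac1. Qed.
Lemma lpolyX : lpoly 'X = zL.
Proof. exact: val_inj. Qed.
Lemma lpoly_eq0 p : lpoly p = 0 -> p = 0.
Proof. by move=> /(congr1 val)/eqP /=; rewrite tofrac_eq0 => /eqP. Qed.

Lemma laurent_idomain (x y : Laurent) : x * y = 0 -> x = 0 \/ y = 0.
Proof.
move=> /(congr1 val)/eqP; rewrite rmorphM /= mulf_eq0.
by case/orP => /eqP e; [left|right]; apply: val_inj.
Qed.

(** The surplus exponent [k] allows finitely many elements to be cleared by one common power of
    z. *)
Lemma laurent_clear (x : Laurent) : exists n p, forall k, zL ^+ (n + k) * x = lpoly ('X^k * p).
Proof.
have /asboolP [p [n e]] := laurent_valP x; exists n, p => k; apply: val_inj.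
rewrite rmorphM rmorphXn /= e exprD -!tofracXn tofracM.
rewrite [X in X * _]mulrC -mulrA; congr (_ * _).
by rewrite mulrCA mulfV ?mulr1 // Xn_frac_neq0.
Qed.

Definition lconst (c : CC) : Laurent := lpoly c%:P.

Definition cong1 (x : Laurent) (c : CC) := exists y, x = lconst c + (zL - 1) * y.

Lemma cong1_const c : cong1 (lconst c) c.
Proof. by exists 0; rewrite mulr0 addr0. Qed.

Lemma cong1D x y c d : cong1 x c -> cong1 y d -> cong1 (x + y) (c + d).
Proof.
move=> [x' ->] [y' ->]; exists (x' + y').
by rewrite /lconst polyCD lpolyD mulrDr addrACA.
Qed.

Lemma cong1M x y c d : cong1 x c -> cong1 y d -> cong1 (x * y) (c * d).
Proof.
move=> [x' ->] [y' ->]; exists (x' * lconst d + lconst c * y' + (zL - 1) * (x' * y')).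
rewrite /lconst polyCM lpolyM; ring.
Qed.

Lemma cong1_0 : cong1 0 0.
Proof. by have := cong1_const 0; rewrite /lconst polyC0 lpoly0. Qed.
Lemma cong1_1 : cong1 1 1.
Proof. by have := cong1_const 1; rewrite /lconst polyC1 lpoly1. Qed.

Lemma cong1N x c : cong1 x c -> cong1 (- x) (- c).
Proof.
move=> [x' ->]; exists (- x'); rewrite /lconst polyCN mulrN opprD.
by rewrite -[in RHS]sub0r lpolyB lpoly0 sub0r.
Qed.

Lemma cong1_zL : cong1 zL 1.
Proof. by exists 1; rewrite /lconst polyC1 lpoly1 mulr1 addrC subrK. Qed.

Lemma cong1_zLinv : cong1 zLinv 1.
Proof.
exists (- zLinv); rewrite /lconst polyC1 lpoly1 mulrN mulrBl zL_zLinv mul1r.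
by rewrite opprB addrC subrK.
Qed.

Lemma cong1_zp k : cong1 (zp k) 1.
Proof.
have X x n : cong1 x 1 -> cong1 (x ^+ n) 1.
  move=> cx; elim: n => [|n IH]; first exact: cong1_1.
  by rewrite exprS -[1]mulr1; apply: cong1M.
by case: k => n; apply: X; [apply: cong1_zL|apply: cong1_zLinv].
Qed.

Lemma cong1_poly p : cong1 (lpoly p) p.[1].
Proof.
have /factor_theorem[q e] : root (p - p.[1]%:P) 1 by rewrite /root !hornerE subrr.
exists (lpoly q); rewrite mulrC -lpolyX -lpoly1 -lpolyB -lpolyM -polyC1 -e -lpolyD.
by rewrite addrC subrK.
Qed.

(** Clearing denominators turns the congruence into an identity of polynomials; it is evaluated at
    1, where the power of z used for clearing is 1. *)
Lemma cong1_uniq x c d : cong1 x c -> cong1 x d -> c = d.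
Proof.
suff H e : cong1 0 e -> e = 0.
  move=> xc xd; apply/eqP; rewrite -subr_eq0; apply/eqP/H.
  by rewrite -(subrr x); apply: cong1D xc (cong1N xd).
case=> y e0; have [n [p clr]] := laurent_clear y.
have {}clr := clr 0%N; rewrite addn0 mul1r in clr.
have : lpoly ('X^n * e%:P + ('X - 1) * p) = 0.
  rewrite lpolyD !lpolyM lpolyB lpoly1 lpolyX -clr mulrCA.
  have -> : lpoly 'X^n = zL ^+ n by apply: val_inj; rewrite rmorphXn /= tofracXn.
  by rewrite -mulrDr -/(lconst e) -e0 mulr0.
by move=> /lpoly_eq0/(congr1 (fun q => q.[1])); rewrite !hornerE expr1n subrr mul0r mul1r addr0.
Qed.

Section ClassicalLimit.
Variable N : nat.
Local Notation E := (endo N).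
Implicit Types (f : E).

Definition scong (u : state N) (c : CC) := forall s, cong1 (u s) c.
(** The eigenvector condition is imposed on all functions congruent to a constant, not only on
    constants, which makes it stable under composition. *)
Definition ocong f (k : CC) := forall u c, scong u c -> scong (f u) (k * c).

Lemma ocongD f h k l : ocong f k -> ocong h l -> ocong (f + h) (k + l).
Proof. by move=> cf ch u c uc s; rewrite mulrDl; apply: cong1D; [apply: cf|apply: ch]. Qed.
Lemma ocongM f h k l : ocong f k -> ocong h l -> ocong (f * h) (k * l).
Proof. by move=> cf ch u c uc s; rewrite -mulrA; apply/cf/ch. Qed.
Lemma ocongZ r f d k : cong1 r d -> ocong f k -> ocong (r *: f) (d * k).
Proof. by move=> cr cf u c uc s; rewrite -mulrA; apply: cong1M cr _; apply: cf. Qed.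
Lemma ocongN f k : ocong f k -> ocong (- f) (- k).
Proof. by move=> cf u c uc s; rewrite mulNr; apply/cong1N/cf. Qed.
Lemma ocong0 : ocong 0 0.
Proof. by move=> u c uc s; rewrite mul0r; apply: cong1_0. Qed.
Lemma ocong1 : ocong 1 1.
Proof. by move=> u c uc s; rewrite mul1r; apply: uc. Qed.
Lemma ocong_site i a b phi k : (forall nu, cong1 (phi nu) k) -> ocong (site_op i a b phi) k.
Proof. by move=> cphi u c uc s; apply: cong1M. Qed.
Lemma ocong_sum (I : Type) (r : seq I) (P : pred I) (F : I -> E) (G : I -> CC) :
  (forall i, ocong (F i) (G i)) -> ocong (\sum_(i <- r | P i) F i) (\sum_(i <- r | P i) G i).
Proof.
move=> FG; elim/big_rec2: _ => [|i k f _ IH]; first exact: ocong0.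
exact: ocongD.
Qed.
Lemma ocong_prod (I : Type) (r : seq I) (F : I -> E) (G : I -> CC) :
  (forall i, ocong (F i) (G i)) -> ocong (\prod_(i <- r) F i) (\prod_(i <- r) G i).
Proof.
move=> FG; elim/big_rec2: _ => [|i k f _ IH]; first exact: ocong1.
exact: ocongM.
Qed.

Definition pcong (p : {poly E}) (q : {poly CC}) := forall r, ocong p`_r q`_r.

Lemma pcongM p p' q q' : pcong p q -> pcong p' q' -> pcong (p * p') (q * q').
Proof. by move=> cp cp' r; rewrite !coefM; apply: ocong_sum => i; apply: ocongM. Qed.
Lemma pcong_sum (I : finType) (F : I -> {poly E}) (G : I -> {poly CC}) :
  (forall i, pcong (F i) (G i)) -> pcong (\sum_i F i) (\sum_i G i).
Proof. by move=> FG r; rewrite !coef_sum; apply: ocong_sum => i; apply: FG. Qed.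

(* At z = 1 the block with these parameters is scalar outside column [pcol]. *)
Record params := Params {
  pcol : 'I_N; pkappa : CC; plam : 'I_N -> CC; pspec : CC;
  pkappa0 : pkappa != 0; plam0 : forall l, plam l != 0; pspec0 : pspec != 0 }.

Variable t : params.
Let b0 := pcol t.

Definition tkap l : Laurent := if l == b0 then lconst (pkappa t) else 1.
Definition tkap' l : Laurent := if l == b0 then lconst (pkappa t)^-1 else 1.
(** For [l] other than [b0] the product z^n - z^-n vanishes at z = 1, and this factor goes into
    [tbe]: it kills the off-diagonal entries of all columns but [b0], where [tbe] is 1 and the
    entries become the values [plam]. The shift n + 1 in [tbe] compensates for the argument n - 1 in
    the oscillator relation. *)
Definition tal l n : Laurent :=
  if l == b0 then lconst (pkappa t) * zp n - lconst (pkappa t)^-1 * zp (- n)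
  else lconst (plam t l).
Definition tbe l n : Laurent :=
  if l == b0 then 1 else lconst (plam t l)^-1 * (zp (n + 1) - zp (- (n + 1))).

Lemma lconstV c : c != 0 -> lconst c * lconst c^-1 = 1.
Proof. by move=> c0; rewrite /lconst -lpolyM -polyCM mulfV // polyC1 lpoly1. Qed.

Lemma tal_be l n : tal l n * tbe l (n - 1) = tkap l * zp n - tkap' l * zp (- n).
Proof.
rewrite /tal /tbe /tkap /tkap'; case: eqP => _; first by rewrite mulr1.
by rewrite subrK mulrA lconstV ?plam0 // !mul1r.
Qed.

Lemma tkapK l : tkap l * tkap' l = 1.
Proof. by rewrite /tkap /tkap'; case: eqP => _; rewrite ?mulr1 // lconstV ?pkappa0. Qed.

Definition block_of : block N := Block tal_be tkapK (lconstV (pspec0 t)).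

Definition clow (a b : 'I_N) : CC :=
  if (b < a)%N then (if b == b0 then plam t a else 0)
  else if val a == val b then (if a == b0 then pkappa t else 1) else 0.
Definition cupp (a b : 'I_N) : CC :=
  if (a < b)%N then (if b == b0 then - plam t a else 0)
  else if val a == val b then (if a == b0 then (pkappa t)^-1 else 1) else 0.

Lemma cong1_ell a b nu : a != b -> cong1 (ell tal tbe a b nu) (if b == b0 then plam t a else 0).
Proof.
move=> ab; rewrite /ell -[X in cong1 _ X]mulr1.
have W : cong1 (zp (om a nu) * zp (- om b nu) * zp (Posz (a < b)%N)) 1.
  by rewrite -[1]mulr1; apply: cong1M (cong1_zp _); rewrite -[1]mulr1; apply: cong1M; apply: cong1_zp.
apply: cong1M W; rewrite /tal /tbe; case: (eqVneq b b0) => [eb|nb].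
  rewrite -eb (negPf ab) mulr1; exact: cong1_const.
have B0 : cong1 (lconst (plam t b)^-1 * (zp (nu b + 1) - zp (- (nu b + 1)))) 0.
  rewrite -(mulr0 (plam t b)^-1); apply: cong1M; first exact: cong1_const.
  by rewrite -(subrr 1); apply: cong1D; [|apply: cong1N]; apply: cong1_zp.
case: eqP => _.
  rewrite -(mulr0 (pkappa t * 1 - (pkappa t)^-1 * 1)); apply: cong1M B0.
  by apply: cong1D; [|apply: cong1N]; apply: cong1M; do ?[apply: cong1_zp]; apply: cong1_const.
by rewrite -(mulr0 (plam t a)); apply: cong1M B0; apply: cong1_const.
Qed.

Lemma cong1_low a b nu : cong1 (Mlow tkap tal tbe a b nu) (clow a b).
Proof.
rewrite /Mlow /clow; case: (ltngtP a b) => ab; first exact: cong1_0.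
  by apply: cong1_ell; rewrite neq_ltn ab orbT.
rewrite -[X in cong1 _ X]mulr1 /tkap; apply: cong1M (cong1_zp _).
by case: eqP => _; [apply: cong1_const | apply: cong1_1].
Qed.

Lemma cong1_upp a b nu : cong1 (Mupp tkap' tal tbe a b nu) (cupp a b).
Proof.
rewrite /Mupp /cupp; case: (ltngtP a b) => ab; last 1 first.
- rewrite -[X in cong1 _ X]mulr1 /tkap'; apply: cong1M (cong1_zp _).
  by case: eqP => _; [apply: cong1_const | apply: cong1_1].
- rewrite -[0]oppr0 -[if _ then - _ else _](fun_if -%R); apply/cong1N/cong1_ell.
  by rewrite neq_ltn ab.
exact: cong1_0.
Qed.

Definition blockQ bar a b : {poly CC} :=
  if bar then (cupp a b)%:P - 'X * ((pspec t)^-1 * clow a b)%:P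
  else (clow a b)%:P - 'X * (pspec t * cupp a b)%:P.

End ClassicalLimit.

Lemma blockPQ N (t : nat -> params N) i bar a b :
  pcong (blockP (fun i => block_of (t i)) i bar a b) (blockQ (t i) bar a b).
Proof.
move=> r; rewrite blockP_coef.
have L : ocong (Elow (tkap (t i)) (tal (t i)) (tbe (t i)) i a b) (clow (t i) a b).
  by apply: ocong_site => nu; apply: cong1_low.
have U : ocong (Eupp (tkap' (t i)) (tal (t i)) (tbe (t i)) i a b) (cupp (t i) a b).
  by apply: ocong_site => nu; apply: cong1_upp.
rewrite /blockQ; case: bar; rewrite coefB coefXM !coefC; case: r => [|[|r]] /=;
  rewrite ?subr0 ?sub0r //; try exact: ocong0; apply: ocongN; apply: ocongZ => //; exact: cong1_const.
Qed.

Fixpoint prodQ N (t : nat -> params N) m bar : 'I_N -> 'I_N -> {poly CC} :=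
  if m is i.+1 then entry_mul (prodQ t i bar) (blockQ (t i) bar) else @entry_one N _.

Lemma prodPQ N (t : nat -> params N) m bar a b :
  pcong (prodP (fun i => block_of (t i)) m bar a b) (prodQ t m bar a b).
Proof.
elim: m a b => [|m IH] a b /=.
  move=> r; rewrite /entry_one; case: eqP => _; last by rewrite !coef0; apply: ocong0.
  by rewrite !coef1; case: eqP => _; [apply: ocong1 | apply: ocong0].
by apply: pcong_sum => e; apply: pcongM => //; apply: blockPQ.
Qed.

Definition classical_gen N (t : nat -> params N) m (x : gen N) : CC :=
  (prodQ t m (gbar x) (grow x) (gcol x))`_(gdeg x).

Lemma monomial_cong N (t : nat -> params N) m (w : seq (gen N)) :
  ocong (monomial (poly_gen (prodP (fun i => block_of (t i)) m)) w)
        (\prod_(x <- w) classical_gen t m x).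
Proof. by apply: ocong_prod => x; apply: prodPQ. Qed.

(** * Realization of prescribed classical values *)

HB.instance Definition _ := GRing.ClosedField.on CC.

Lemma CC_natr_inj (m n : nat) : m%:R = n%:R :> CC -> m = n.
Proof. by move=> e; apply/eqP; rewrite -(eqr_nat (complex Rdefinitions.R)); apply/eqP. Qed.

Lemma CC_sqrt (x : CC) : exists y, y ^+ 2 = x.
Proof.
have [|y /rootP] := closed_rootP ('X^2 - x%:P : {poly CC}) _.
  by rewrite size_XnsubC.
by rewrite !hornerE => /subr0_eq e; exists y.
Qed.

(** * Power series modulo degree K + 1 *)

Section Truncation.
Variable K : nat.
Local Notation Q := {poly %/ ('X^(K.+1) : {poly CC})}.
Definition tq (p : {poly CC}) : Q := in_qpoly 'X^(K.+1) p.
HB.instance Definition _ := GRing.RMorphism.copy tq (in_qpoly ('X^(K.+1) : {poly CC})).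

Lemma tqD p q : tq (p + q) = tq p + tq q. Proof. exact: rmorphD. Qed.
Lemma tqM p q : tq (p * q) = tq p * tq q. Proof. exact: rmorphM. Qed.
Lemma tq0 : tq 0 = 0. Proof. exact: rmorph0. Qed.
Lemma tq1 : tq 1 = 1. Proof. exact: rmorph1. Qed.

Lemma tq_val p : tq p = take_poly K.+1 p :> {poly CC}.
Proof. by rewrite /= mk_monic_Xn Pdiv.RingMonic.take_poly_rmodp. Qed.

Lemma tqP p q : tq p = tq q <-> forall r, (r <= K)%N -> p`_r = q`_r.
Proof.
split=> [e r rK|e].
  have := congr1 (fun x : Q => (x : {poly CC})`_r) e.
  by rewrite !tq_val !coef_take_poly ltnS rK.
apply: val_inj; rewrite [LHS]tq_val [RHS]tq_val; apply/polyP => r; rewrite !coef_take_poly.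
by case: ifP => // rK; apply: e.
Qed.

Lemma tq_unit (p : {poly CC}) : p`_0 != 0 -> exists q, tq (p * q) = 1 /\ q`_0 = (p`_0)^-1.
Proof.
move=> p0; have : coprimep p 'X^(K.+1).
  by rewrite coprimep_expr // -['X]subr0 -polyC0 coprimep_XsubC /root horner_coef0.
case/Bezout_eq1_coprimepP => [[u v]] /= e; exists u; split.
  rewrite -(rmorph1 tq); apply/tqP => r rK; rewrite -e coefD coefMXn ltnS rK addr0.
  by rewrite mulrC.
have := congr1 (fun q : {poly CC} => q`_0) e; rewrite coefD coefMXn /= addr0 coef0M coef1 /= => e0.
by apply: (mulIf p0); rewrite e0 mulVf.
Qed.

Lemma geometric_inverse (c : CC) :
  tq (1 - c%:P * 'X) * tq (\poly_(r < K.+1) c ^+ r) = 1.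
Proof.
rewrite -rmorphM -(rmorph1 tq); apply/tqP => r rK; rewrite mulrBl mul1r coefB -mulrA coefCM coefXM.
rewrite !coef_poly ltnS rK coef1; case: r rK => [|r] rK /=; first by rewrite mulr0 subr0.
by rewrite ltnS (ltnW rK) exprS subrr.
Qed.

End Truncation.

Section ReciprocalProducts.
Variable F : fieldType.
Implicit Types (r : seq F).

Lemma coef_reciprocal r k : (k <= size r)%N ->
  (\prod_(a <- r) (1 - a%:P * 'X))`_k = (\prod_(a <- r) ('X - a%:P))`_(size r - k).
Proof.
have sz1 s : (size (\prod_(a <- s) (1 - a%:P * 'X) : {poly F})%R <= (size s).+1)%N.
  elim: s => [|a s IH]; first by rewrite big_nil size_poly1.
  have sz : (size (1 - a%:P * 'X : {poly F})%R <= 2)%N.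
    apply/leq_sizeP => -[|[|j]] // _.
    by rewrite coefB coefCM coefX coef1 mulr0 subr0.
  rewrite big_cons; apply: leq_trans (size_polyMleq _ _) _.
  by move: (leq_add sz IH) => /=; case: (_ + _)%N.
elim: r k => [|a r IH] k; first by rewrite leqn0 => /eqP->; rewrite !big_nil.
rewrite !big_cons !mulrBl !mul1r !coefB -mulrA !coefCM !coefXM => kr.
have sz2 : (size (\prod_(b <- r) ('X - b%:P))%R <= (size r).+1)%N by rewrite size_prod_XsubC.
move: kr; rewrite /= leq_eqVlt => /predU1P[->|].
  by rewrite subnn /= (nth_default 0 (sz1 r)) IH // subnn.
rewrite ltnS => kr; rewrite subSn //=.
case: k kr => [|k] kr /=; first by rewrite IH // subn0 [in RHS](nth_default 0 sz2) mulr0.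
by rewrite !IH //; last exact: ltnW; rewrite subnSK.
Qed.

Lemma prod_inverse_roots r : 0 \notin r ->
  \prod_(a <- r) (1 - (a^-1)%:P * 'X) = ((\prod_(a <- r) (- a))^-1)%:P * \prod_(a <- r) ('X - a%:P).
Proof.
elim: r => [|a r IH]; first by rewrite !big_nil invr1 mul1r.
rewrite inE negb_or eq_sym => /andP[a0 r0]; rewrite !big_cons IH // invfM polyCM mulrACA; congr (_ * _).
by rewrite invrN mulrBr polyCN !mulNr opprK addrC -polyCM mulVf.
Qed.

End ReciprocalProducts.

(** * Matrices that are scalar outside one column *)

Section ColumnMatrices.
Variables (N : nat) (R : comNzRingType).
Implicit Types (b : 'I_N) (s : R) (v : 'I_N -> R).

Definition colmx b s v : 'M[R]_N :=
  \matrix_(i, j) if j == b then v i else if i == j then s else 0.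

Lemma eq_colmx b s v v' : v =1 v' -> colmx b s v = colmx b s v'.
Proof. by move=> e; apply/matrixP => i j; rewrite !mxE e. Qed.

Lemma colmx_mulE b s v (M : 'M[R]_N) i j :
  (colmx b s v *m M) i j = if i == b then v b * M b j else s * M i j + v i * M b j.
Proof.
rewrite mxE (bigD1 b) //= !mxE eqxx; case: (eqVneq i b) => [->|ib].
  rewrite big1 ?addr0 // => k kb; rewrite mxE (negPf kb) eq_sym (negPf kb) mul0r //.
rewrite (bigD1 i) //= mxE (negPf ib) eqxx big1 ?addr0 1?addrC // => k /andP[kb ki].
by rewrite mxE (negPf kb) eq_sym (negPf ki) mul0r.
Qed.

Lemma colmxM b s s' v v' : colmx b s v *m colmx b s' v' =
  colmx b (s * s') (fun i => if i == b then v b * v' b else s * v' i + v i * v' b).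
Proof.
apply/matrixP => i j; rewrite colmx_mulE !mxE; have [_ //|jb] := eqVneq j b.
rewrite !mulr0 addr0.
case: (eqVneq i b) => [->|ib]; first by rewrite eq_sym (negPf jb).
by case: eqP; rewrite ?mulr0.
Qed.

Lemma colmx1 b : colmx b 1 (fun i => if i == b then 1 else 0) = 1%:M.
Proof.
apply/matrixP => i j; rewrite !mxE; case: (eqVneq j b) => [->|jb].
  by case: eqP.
by case: eqP.
Qed.

End ColumnMatrices.

Section Realizable.
Variables (N K : nat).
Local Notation Q := {poly %/ ('X^(K.+1) : {poly CC})}.
Local Notation tq := (tq K).
Implicit Types (b : 'I_N) (p : params N) (bar : bool).

Definition bmx p bar : 'M[Q]_N := \matrix_(i, j) tq (blockQ p bar i j).

(** A single list of blocks has to produce the unbarred and the barred matrix at the same time. *)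
Definition realizable (M : bool -> 'M[Q]_N) : Prop :=
  exists s : seq (params N), forall bar, M bar = \prod_(p <- s) bmx p bar.

Lemma realizableM M M' : realizable M -> realizable M' ->
  realizable (fun bar => M bar *m M' bar).
Proof.
by move=> [s sM] [s' sM']; exists (s ++ s') => bar; rewrite big_cat sM sM'.
Qed.

Lemma eq_realizable M M' : (forall bar, M bar = M' bar) -> realizable M' -> realizable M.
Proof. by move=> e [s sM]; exists s => bar; rewrite e. Qed.

Lemma realizable1 : realizable (fun=> 1%:M).
Proof. by exists [::] => bar; rewrite big_nil. Qed.

Definition sspec p bar : CC := if bar then (pspec p)^-1 else pspec p.
Definition skap p bar : CC := if bar then (pkappa p)^-1 else pkappa p.

Definition bdiag p bar : {poly CC} := 1 - (sspec p bar)%:P * 'X.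
Definition bcol p bar (a : 'I_N) : {poly CC} :=
  if a == pcol p then (skap p bar)%:P - (sspec p bar * skap p (~~ bar))%:P * 'X
  else if (if bar then a < pcol p else pcol p < a)%N
  then (if bar then - plam p a else plam p a)%:P
  else (if bar then - (sspec p bar * plam p a) else sspec p bar * plam p a)%:P * 'X.

Lemma bmxE p bar : bmx p bar = colmx (pcol p) (tq (bdiag p bar)) (fun a => tq (bcol p bar a)).
Proof.
apply/matrixP => i j; rewrite !mxE; case: (eqVneq j (pcol p)) => [->|jb].
  congr (tq _); rewrite /bcol /blockQ /clow /cupp /sspec /skap -!val_eqE /=.
  case: bar => /=; case: (ltngtP i (pcol p)) => lt; rewrite ?eqxx ?polyC0 ?mulr0 ?polyC0 ?mulr0 ?subr0 ?sub0r //.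
  1-4: by rewrite -commr_polyX ?mulrN ?polyCN ?mulNr ?opprK.
rewrite /blockQ /clow /cupp /bdiag /sspec (negPf jb) -val_eqE /=.
have [->|ij] := eqVneq i j.
  move: jb; rewrite -val_eqE => /negPf jb; rewrite ltnn eqxx jb !mulr1 polyC1; congr (tq _).
  by case: bar; rewrite -commr_polyX.
move: ij; rewrite -val_eqE /=; case: (ltngtP i j) => // _ _;
  by rewrite ?mulr0 ?polyC0 ?mulr0 ?subr0 if_same tq0.
Qed.

Definition geom p bar : {poly CC} := \poly_(r < K.+1) (sspec p bar) ^+ r.

Lemma bcol_geom p bar a :
  tq (bcol p bar a) = tq (bdiag p bar) * tq (bcol p bar a * geom p bar).
Proof. by rewrite tqM mulrCA geometric_inverse mulr1. Qed.

(** With [pkappa] equal to 1 the entry at (b, b) is the same scalar as elsewhere on the diagonal, so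
    a block is a scalar times a unipotent column matrix. Unipotent factors multiply by adding their
    columns; [geom] inverts the scalar. *)
Lemma unipotent_batch (s : seq (params N)) b bar :
  all (fun p => (pcol p == b) && (pkappa p == 1)) s ->
  \prod_(p <- s) bmx p bar =
  colmx b (tq (\prod_(p <- s) bdiag p bar))
    (fun a => tq (\prod_(p <- s) bdiag p bar) *
       (if a == b then 1 else tq (\sum_(p <- s) bcol p bar a * geom p bar))).
Proof.
elim: s => [|p s IH] /=.
  move=> _; rewrite !big_nil tq1 -[LHS]/(1%:M) -(colmx1 _ b); apply: eq_colmx => a.
  by rewrite big_nil tq0 mul1r.
case/andP=> /andP[/eqP pb /eqP pk1] /IH {}IH; rewrite !big_cons IH bmxE pb.
rewrite -[LHS]/(_ *m _) colmxM tqM; apply: eq_colmx => a.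
have eb : tq (bcol p bar b) = tq (bdiag p bar).
  by rewrite /bcol -pb eqxx /bdiag /skap pk1 invr1 !if_same mulr1 polyC1.
rewrite eqxx eb; have [//|ab] := eqVneq a b; first by rewrite !mulr1.
rewrite big_cons (tqD _ (bcol p bar a * _)) bcol_geom; ring.
Qed.

(** Only the entry at (b, b) is computed. The others need only vanish in degree 0 where
    triangularity demands it, as a unipotent factor corrects them later. *)
Lemma general_batch (s : seq (params N)) b bar :
  all (fun p => pcol p == b) s ->
  exists h : 'I_N -> {poly CC},
    (forall a : 'I_N, (if bar then b < a else a < b)%N -> (h a)`_0 = 0) /\
    \prod_(p <- s) bmx p bar =
    colmx b (tq (\prod_(p <- s) bdiag p bar))
     (fun a => if a == b then tq (\prod_(p <- s) bcol p bar b) else tq (h a)).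
Proof.
elim: s => [|p s IH] /=.
  move=> _; exists (fun=> 0); split=> [a _|]; first by rewrite coef0.
  by rewrite !big_nil !tq1 -[LHS]/(1%:M) -(colmx1 _ b); apply: eq_colmx => a; rewrite tq0.
case/andP=> /eqP pb /IH[h [h0 e]].
exists (fun a => bdiag p bar * h a + bcol p bar a * \prod_(p <- s) bcol p bar b); split.
  move=> a ba; rewrite coefD !coef0M (h0 a) // mulr0 add0r.
  have -> : (bcol p bar a)`_0 = 0; last by rewrite mul0r.
  have nab : a == b = false by case: (bar) ba => ba; rewrite -val_eqE /= ?(ltn_eqF ba) ?(gtn_eqF ba).
  rewrite /bcol pb nab ifF; last by case: (bar) ba => ba; rewrite ltnNge ltnW.
  by rewrite coefMX.
rewrite !big_cons e bmxE pb -[LHS]/(_ *m _) colmxM tqM; apply: eq_colmx => a.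
rewrite eqxx; have [_|ab] := eqVneq a b; first by rewrite tqM.
by rewrite [RHS]tqD !tqM.
Qed.

(** The order of the roots of unity. It exceeds 2K, so the exponents -K, ..., K are distinct modulo
    [n], and X^n vanishes modulo X^(K+1). *)
Let n := (K.*2.+2)%N.

Lemma unity_roots : exists c : 'I_n -> CC,
  [/\ injective c, forall j, c j ^+ n = 1 & 'X^n - 1 = \prod_(j < n) ('X - (c j)%:P)].
Proof.
have [rts e] := closed_field_poly_normal ('X^n - 1 : {poly CC}).
have mon : lead_coef ('X^n - 1 : {poly CC}) = 1 by apply/eqP; rewrite -[_ == _]/(_ \is monic) -polyC1 monicXnsubC.
rewrite mon scale1r in e.
have szr : size rts = n.
  have := congr1 (fun p : {poly CC} => size p) e.
  by rewrite -polyC1 size_XnsubC // size_prod_XsubC => -[].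
have n0 : (n%:R : CC) != 0.
  by apply/eqP => /(@CC_natr_inj n 0).
have ur : uniq rts.
  by rewrite -separable_prod_XsubC -e separable_Xn_sub_1.
exists (fun j => rts`_j); split.
- move=> i j /eqP; rewrite nth_uniq ?szr // => /eqP; exact: val_inj.
- move=> j; have : root ('X^n - 1) rts`_j by rewrite e root_prod_XsubC mem_nth ?szr.
  by rewrite /root !hornerE subr_eq0 => /eqP.
by rewrite e (big_nth 0) big_mkord szr.
Qed.

(** For the roots and for their inverses the product is 1 - X^n, which is 1 after truncation. *)
Lemma unity_batch (c : 'I_n -> CC) bar : 'X^n - 1 = \prod_(j < n) ('X - (c j)%:P) ->
  tq (\prod_(j < n) (1 - (if bar then (c j)^-1 else c j)%:P * 'X)) = 1.
Proof.
move=> e; pose r := [seq c j | j <- enum 'I_n].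
have er (F : CC -> {poly CC}) : \prod_(j < n) F (c j) = \prod_(a <- r) F a.
  by rewrite big_map big_enum.
have szr : size r = n by rewrite size_map size_enum_ord.
rewrite (er (fun a => 'X - a%:P)) in e; rewrite -(tq1 K); apply/tqP => k kK.
have r0 : 0 \notin r.
  by rewrite -root_prod_XsubC -e /root !hornerE expr0n /= sub0r oppr_eq0 oner_eq0.
have p0 : \prod_(a <- r) (- a) = -1.
  have := congr1 (fun p : {poly CC} => p.[0]) e.
  rewrite !hornerE expr0n /= sub0r horner_prod => ->.
  by apply: eq_bigr => a _; rewrite !hornerE.
have en : (n - k == 0)%N = false by apply/negbTE; rewrite /n; lia.
have kn : (k == n)%N = false by apply/negbTE; rewrite /n; lia.
case: bar; last first.
  rewrite (er (fun a => 1 - a%:P * 'X)) coef_reciprocal szr; last by rewrite /n; lia.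
  rewrite -e coefB coefXn !coef1 en subr0; congr (_%:R).
  by apply/eqP; rewrite /n; case: (k); lia.
rewrite (er (fun a => 1 - (a^-1)%:P * 'X)) prod_inverse_roots // p0 invrN invr1 -e.
by rewrite coefCM coefB coefXn kn coef1 mulN1r sub0r opprK.
Qed.

Lemma interpolation (c : 'I_n -> CC) (f : 'I_n -> CC) : injective c ->
  exists lam : 'I_n -> CC, forall r : 'I_n, \sum_(j < n) lam j * c j ^+ r = f r.
Proof.
move=> c_inj; pose V : 'M[CC]_n := Vandermonde n (\row_j c j).
have Vu : V \in unitmx.
  rewrite unitmxE det_Vandermonde unitfE; apply/prodf_neq0 => i _; apply/prodf_neq0 => j ij.
  by rewrite !mxE subr_eq0 (inj_eq c_inj) -val_eqE gtn_eqF.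
exists (fun j => (invmx V *m (\col_r f r)) j 0) => r.
have := congr1 (fun M : 'cV[CC]_n => M r 0) (mulKVmx Vu (\col_r f r)).
rewrite !mxE => <-; apply: eq_bigr => j _.
rewrite mulrC; congr (_ * _); by rewrite !mxE.
Qed.

Variables (c : 'I_n -> CC).
Hypotheses (c_inj : injective c) (c_unity : forall j, c j ^+ n = 1).
Hypothesis c_prod : 'X^n - 1 = \prod_(j < n) ('X - (c j)%:P).

Lemma c_neq0 j : c j != 0.
Proof. by apply/eqP => c0; have /eqP := c_unity j; rewrite c0 expr0n /= eq_sym oner_eq0. Qed.

(** The column of a batch whose spectral parameters run through all [c j]. Its coefficients are the
    power sums of the [c j] weighted by [lam], with exponents r for the unbarred series and -r, with
    a minus sign, for the barred one. *)
Definition upoly b (lam : 'I_n -> 'I_N -> CC) bar (a : 'I_N) : {poly CC} :=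
  \poly_(r < K.+1) (if (r == 0) && ~~ (if bar then a < b else b < a)%N then 0
    else (if bar then -1 else 1) * \sum_(j < n) lam j a * (if bar then (c j)^-1 else c j) ^+ r).

Lemma unipotent_nodes b (lam : 'I_n -> 'I_N -> CC) : (forall j l, lam j l != 0) ->
  realizable (fun bar => colmx b 1 (fun a => if a == b then 1 else tq (upoly b lam bar a))).
Proof.
move=> lam0; pose t j := Params b (oner_neq0 CC) (lam0 j) (c_neq0 j).
exists [seq t j | j <- enum 'I_n] => bar; rewrite (@unipotent_batch _ b); last first.
  by rewrite all_map; apply/allP => j _ /=; rewrite !eqxx.
have -> : tq (\prod_(p <- [seq t j | j <- enum 'I_n]) bdiag p bar) = 1.
  by rewrite big_map big_enum /= -(unity_batch bar c_prod).
apply: eq_colmx => a; have [//|ab] := eqVneq a b; first by rewrite mulr1.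
have sumI (F : 'I_n -> {poly CC}) : \sum_(j <- enum 'I_n) F j = \sum_(j < n) F j by rewrite big_enum.
rewrite mul1r; apply/esym/tqP => r rK; rewrite big_map sumI coef_sum coef_poly ltnS rK.
have ab' : (if bar then b < a else a < b)%N = ~~ (if bar then a < b else b < a)%N.
  by move: ab; rewrite -val_eqE /=; case: bar; case: ltngtP.
case: ifP => [/andP[/eqP-> tri]|tri].
  apply: big1 => j _; rewrite /bcol /= (negPf ab) (negPf tri) -mulrA coefCM.
  by rewrite -commr_polyX coefMX mulr0.
rewrite mulr_sumr; apply: eq_bigr => j _; rewrite /bcol /= (negPf ab).
case: ifP => tri'.
  by rewrite coefCM /geom coef_poly ltnS rK; case: bar {tri tri' ab'}; rewrite ?mulN1r ?mul1r // mulNr.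
case: r rK tri => [|r] rK tri; first by rewrite tri' in tri.
rewrite -mulrA coefCM coefXM /= /geom coef_poly ltnS (ltnW rK) /sspec /= exprS.
by case: bar {tri tri' ab'}; ring.
Qed.

(** The parameters of a block are nonzero, but every number is a sum of two nonzero ones, and
    multiplying two unipotent column matrices adds their columns. *)
Lemma unipotent_any b (lam : 'I_n -> 'I_N -> CC) :
  realizable (fun bar => colmx b 1 (fun a => if a == b then 1 else tq (upoly b lam bar a))).
Proof.
have two0 : (2%:R : CC) != 0 by apply/eqP => /(@CC_natr_inj 2 0).
pose h x : CC := if x == 0 then 1 else x / 2%:R.
have h0 x : h x != 0 by rewrite /h; case: (eqVneq x 0) => x0; [exact: oner_neq0 | rewrite mulf_neq0 ?invr_eq0].
have h0' x : x - h x != 0.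
  rewrite /h; case: (eqVneq x 0) => [->|x0]; first by rewrite sub0r oppr_eq0 oner_neq0.
  by rewrite -[X in X - _](mulfK two0) -mulrBl mulr_natr mulrS mulr1n addrK mulf_neq0 ?invr_eq0.
apply: eq_realizable (realizableM (@unipotent_nodes b (fun j l => h (lam j l)) _)
   (@unipotent_nodes b (fun j l => lam j l - h (lam j l)) _)) => // bar.
rewrite colmxM mulr1; apply: eq_colmx => a; rewrite eqxx; have [//|ab] := eqVneq a b.
  by rewrite mulr1.
rewrite mul1r mulr1 -tqD; congr (tq _); apply/polyP => r; rewrite coefD !coef_poly.
case: ifP => _; last by rewrite addr0.
case: ifP => _; first by rewrite addr0.
rewrite -mulrDr -big_split /=; congr (_ * _); apply: eq_bigr => j _.
by rewrite -mulrDl subrK.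
Qed.

Definition admissible b (v : bool -> 'I_N -> {poly CC}) :=
  forall bar (a : 'I_N), (if bar then b < a else a < b)%N -> (v bar a)`_0 = 0.

Lemma unipotent_realizable b v : admissible b v ->
  realizable (fun bar => colmx b 1 (fun a => if a == b then 1 else tq (v bar a))).
Proof.
move=> adm.
(* Residues up to K carry the unbarred coefficients; n - r stands for -r and carries the barred
   ones. The residue 0 is shared, but triangularity leaves only one of the two constant terms
   free. *)
pose f (a : 'I_N) (r : 'I_n) : CC :=
  if val r == 0%N then (if (b < a)%N then (v false a)`_0 else - (v true a)`_0)
  else if (r <= K)%N then (v false a)`_r else - (v true a)`_(n - r).
pose lam a := sval (cid (interpolation (f a) c_inj)).
have lamP a (r : 'I_n) : \sum_(j < n) lam a j * c j ^+ r = f a r := svalP (cid (interpolation (f a) c_inj)) r.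
apply: eq_realizable (unipotent_any b (fun j a => lam a j)) => bar.
apply: eq_colmx => a; case: (eqVneq a b) => // ab; apply/tqP => r rK.
rewrite coef_poly ltnS rK.
have ab' : (if bar then b < a else a < b)%N = ~~ (if bar then a < b else b < a)%N.
  by move: ab; rewrite -val_eqE /=; case: (bar); case: ltngtP.
case: ifP => [/andP[/eqP-> tri]|tri]; first by apply: adm; rewrite ab'.
have rn : (r < n)%N by rewrite /n; lia.
case: bar ab' tri => ab' tri; last first.
  rewrite mul1r (lamP a (Ordinal rn)) /f /= rK; case: eqP tri => // -> /=.
  by move=> /negbFE ->.
rewrite mulN1r; case: r rK rn tri => [|r] rK rn tri.
  move/negbFE: tri => /= ab0.
  have -> : \sum_(j < n) lam a j * (c j)^-1 ^+ 0 = \sum_(j < n) lam a j * c j ^+ Ordinal rn.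
    by apply: eq_bigr => j _; rewrite !expr0.
  by rewrite lamP /f /= ltnNge (ltnW ab0) /= opprK.
have rn' : (n - r.+1 < n)%N by rewrite /n; lia.
have := lamP a (Ordinal rn'); rewrite /f /=.
have -> : (n - r.+1 == 0)%N = false by apply/negbTE; rewrite /n; lia.
have -> : (n - r.+1 <= K)%N = false by apply/negbTE; rewrite /n; lia.
rewrite subKn; last exact: ltnW.
move=> e; rewrite -[LHS]opprK -e; congr (- _); apply: eq_bigr => j _; congr (_ * _); apply/esym.
have cj : c j ^+ r.+1 != 0 by rewrite expf_neq0 ?c_neq0.
by apply: (mulIf cj); rewrite -exprMn mulVf ?c_neq0 // expr1n -exprD subnK ?c_unity // ltnW.
Qed.

End Realizable.

(** * Prescribing the diagonal entry of a column *)

Section Diagonal.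
Variables (N K : nat).
Local Notation tq := (tq K).
Let n := (K.*2.+2)%N.
Variables (c : 'I_n -> CC).
Hypotheses (c_unity : forall j, c j ^+ n = 1).
Hypothesis c_prod : 'X^n - 1 = \prod_(j < n) ('X - (c j)%:P).
Variable D : bool -> {poly CC}.
Hypothesis D0 : (D false)`_0 * (D true)`_0 = 1.
Let p0 := (D false)`_0.
Let q0 := (D true)`_0.

Let c0 j : c j != 0 := c_neq0 c_unity j.

Lemma p0_neq0 : p0 != 0.
Proof. by apply/eqP => e; move/eqP: D0; rewrite -/p0 e mul0r eq_sym oner_eq0. Qed.

Lemma q0E : q0 = p0^-1.
Proof. by apply: (mulfI p0_neq0); rewrite mulfV ?p0_neq0. Qed.

(* The prescribed expansions at infinity and at 0 of one polynomial of large
   degree; its roots give the parameters [pkappa] of the blocks. *)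
Definition glued : {poly CC} :=
  \poly_(r < n.+1) (if (n - r <= K)%N then (D false)`_(n - r)
                    else if (r <= K)%N then - (D true)`_r else 0).

Lemma glued_top r : (r <= K)%N -> glued`_(n - r) = (D false)`_r.
Proof.
move=> rK; have rn : (r <= n)%N by rewrite /n; lia.
by rewrite coef_poly ltnS leq_subr subKn // rK.
Qed.

Lemma glued_bottom r : (r <= K)%N -> glued`_r = - (D true)`_r.
Proof.
move=> rK; rewrite coef_poly ifT; last by rewrite /n; lia.
by rewrite ifF ?rK //; apply/negbTE; rewrite /n; lia.
Qed.

Lemma glued_roots : exists a : 'I_n -> CC,
  [/\ forall j, a j != 0, \prod_j (- a j) = - (q0 / p0) &
      glued = p0%:P * \prod_(j < n) ('X - (a j)%:P)].
Proof.
have lead : glued`_n = p0 by rewrite -[in LHS](subn0 n) glued_top.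
have sz : size glued = n.+1.
  apply/eqP; rewrite eqn_leq size_poly ltnNge; apply/negP => le.
  by have := p0_neq0; rewrite -lead (nth_default _ le) eqxx.
have [rts e] := closed_field_poly_normal glued.
have lc : lead_coef glued = p0 by rewrite /lead_coef sz lead.
rewrite lc in e.
have szr : size rts = n.
  have := congr1 (fun p : {poly CC} => size p) e.
  by rewrite /= size_scale ?p0_neq0 // sz size_prod_XsubC => -[].
have e' : glued = p0%:P * \prod_(j < n) ('X - (rts`_j)%:P).
  by rewrite -mul_polyC (big_nth 0) big_mkord szr in e.
have pa : \prod_(j < n) (- rts`_j) = - (q0 / p0).
  have := congr1 (fun p : {poly CC} => p.[0]) e'.
  rewrite /= !hornerE horner_coef0 glued_bottom // horner_prod -/q0 => h.
  apply: (mulfI p0_neq0); rewrite mulrN mulrCA mulfV ?p0_neq0 // mulr1 h.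
  by congr (_ * _); apply: eq_bigr => j _; rewrite !hornerE.
exists (fun j => rts`_j); split => // j; apply/eqP => a0.
move/eqP: pa; rewrite (bigD1 j) //= a0 oppr0 mul0r eq_sym oppr_eq0 mulf_eq0 invr_eq0.
by rewrite (negPf p0_neq0) q0E invr_eq0 (negPf p0_neq0).
Qed.

(** A block has diagonal entry k - c k^-1 X = k (1 - a X) with k^2 a = c, so k is a square root of c
    / a. The product of the k must be [p0], and its square is already right because [q0] is the
    inverse of [p0]. *)
Lemma balanced_square_roots (a : 'I_n -> CC) :
  (forall j, a j != 0) -> \prod_j (- a j) = - (q0 / p0) ->
  exists k : 'I_n -> CC, [/\ forall j, k j != 0, forall j, k j ^+ 2 * a j = c j & \prod_j k j = p0].
Proof.
move=> a0 pa; pose s j := sval (cid (CC_sqrt (c j / a j))).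
have sP j : s j ^+ 2 = c j / a j := svalP (cid (CC_sqrt (c j / a j))).
have s0 j : s j != 0.
  apply/eqP => sj; have /esym/eqP := sP j.
  by rewrite sj expr0n /= mulf_eq0 invr_eq0 (negPf (c0 j)) (negPf (a0 j)).
have pc : \prod_j (- c j) = -1.
  have := congr1 (fun p : {poly CC} => p.[0]) c_prod.
  rewrite /= !hornerE expr0n /= sub0r horner_prod => ->.
  by apply: eq_bigr => j _; rewrite !hornerE.
have ps : (\prod_j s j) ^+ 2 = p0 ^+ 2.
  rewrite -prodrXl; under eq_bigr => j _ do rewrite sP -mulrNN -invrN.
  rewrite big_split /= pc prodfV pa q0E invrN invfM !invrK mulrNN mul1r //.
pose i0 : 'I_n := ord0.
pose P := \prod_(j | j != i0) s j.
have P0 : P != 0 by apply/prodf_neq0.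
(* The product of the [s j] is [p0] up to sign, so this changes at most the sign of one root. *)
exists (fun j => if j == i0 then p0 / P else s j); split.
- by move=> j; case: (j =P i0) => _ //; rewrite mulf_eq0 invr_eq0 negb_or p0_neq0.
- move=> j; case: (j =P i0) => [->|_]; last by rewrite sP mulfVK.
  rewrite expr_div_n -ps (bigD1 i0) //= -/P exprMn mulfK ?expf_neq0 //.
  by rewrite sP mulfVK.
rewrite (bigD1 i0) //= (eq_bigr s) -/P ?mulfVK // => j /negPf->//.
Qed.

(** The roots of [glued] make the unbarred diagonal entry the reversal of [glued] and the barred one
    its negative, so truncation reads off the leading and the trailing coefficients of one
    polynomial. *)
Lemma diagonal_realizable b : exists h : bool -> 'I_N -> {poly CC}, admissible b h /\
  realizable (fun bar => colmx b 1 (fun a => if a == b then tq (D bar) else tq (h bar a))).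
Proof.
have [a [a0 pa ea]] := glued_roots.
have [k [k0 ka pk]] := balanced_square_roots a0 pa.
pose t j := Params b (k0 j) (fun _ : 'I_N => oner_neq0 CC) (c0 j).
pose s := [seq t j | j <- enum 'I_n].
have sb : all (fun p => pcol p == b) s by rewrite all_map; apply/allP => j _ /=.
have [h1 [adm1 e1]] := general_batch K true sb.
have [h0 [adm0 e0]] := general_batch K false sb.
exists (fun bar => if bar then h1 else h0); split.
  by case=> a'; [apply: adm1 | apply: adm0].
have diag1 bar : tq (\prod_(p <- s) bdiag p bar) = 1.
  by rewrite big_map big_enum /= -(unity_batch bar c_prod).
have prodE (F : 'I_n -> {poly CC}) : \prod_(j <- enum 'I_n) F j = \prod_(j < n) F j by rewrite big_enum.
have mem_r r : (exists i, r = a i) -> r != 0 by move=> [i ->].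
pose r := [seq a j | j <- enum 'I_n].
have rE (F : CC -> {poly CC}) : \prod_(j < n) F (a j) = \prod_(x <- r) F x by rewrite big_map big_enum.
have szr : size r = n by rewrite size_map size_enum_ord.
have col bar : tq (\prod_(p <- s) bcol p bar b) = tq (D bar).
  rewrite big_map prodE; apply/tqP => i iK.
  have in_ : (i <= n)%N by rewrite /n; lia.
  case: bar.
    have -> : \prod_(j < n) bcol (t j) true b = - glued.
      transitivity (\prod_(j < n) (((k j)^-1)%:P * (1 - ((a j)^-1)%:P * 'X)) : {poly CC}).
        apply: eq_bigr => j _; rewrite /bcol eqxx /skap /sspec /= mulrBr mulr1 mulrA -polyCM.
        congr (_ - _%:P * _); rewrite -(ka j); field.
        by rewrite k0 a0.
      rewrite big_split /= (rE (fun x => 1 - (x^-1)%:P * 'X)) prod_inverse_roots; last first.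
        by apply/mapP => -[j _ /esym/eqP]; apply/negP/a0.
      have -> : \prod_(x <- r) (- x) = - (q0 / p0) by rewrite -pa big_map big_enum.
      rewrite -(rE (fun x => 'X - x%:P)) -(rmorph_prod polyC) /= prodfV pk ea.
      rewrite mulrA -polyCM -[RHS]mulNr -polyCN; congr (_%:P * _).
      by rewrite q0E; field; rewrite p0_neq0.
    by rewrite coefN glued_bottom // opprK.
  have -> : \prod_(j < n) bcol (t j) false b = p0%:P * \prod_(j < n) (1 - (a j)%:P * 'X).
    rewrite -pk (rmorph_prod polyC) -big_split /=; apply: eq_bigr => j _.
    rewrite /bcol eqxx /skap /sspec /= mulrBr mulr1 mulrA -polyCM.
    by congr (_ - _%:P * _); rewrite -(ka j); field; rewrite k0.
  rewrite coefCM (rE (fun x => 1 - x%:P * 'X)) coef_reciprocal szr // -(rE (fun x => 'X - x%:P)).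
  by rewrite -coefCM -ea glued_top.
exists s => bar; case: bar.
  by rewrite e1 diag1; apply: eq_colmx => a'; rewrite col.
by rewrite e0 diag1; apply: eq_colmx => a'; rewrite col.
Qed.

End Diagonal.

(** * Factorization of triangular pairs into columns *)

Section Factorization.
Variables (N K : nat).
Local Notation tq := (tq K).
Implicit Types (b : 'I_N) (bar : bool).

(** The matrix with the right diagonal entry and some other entries [h] is followed by a unipotent
    column matrix with entries [v] - [h]; the columns add up off the diagonal. *)
Lemma column_realizable b (v : bool -> 'I_N -> {poly CC}) : admissible b v ->
  (v false b)`_0 * (v true b)`_0 = 1 ->
  realizable (fun bar => colmx b 1 (fun a => tq (v bar a))).
Proof.
move=> adm v0; have [c [c_inj c_unity c_prod]] := unity_roots K.
have [h [admh rh]] := diagonal_realizable c_unity c_prod (D := fun bar => v bar b) v0 b.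
have admg : admissible b (fun bar a => v bar a - h bar a).
  by move=> bar a ba; rewrite coefB adm ?admh ?subrr.
have rg := unipotent_realizable c_inj c_unity c_prod admg.
apply: eq_realizable (realizableM rh rg) => bar.
rewrite colmxM mulr1; apply: eq_colmx => a; rewrite eqxx !mulr1 mul1r.
by have [->|ab] := eqVneq a b; rewrite // -tqD subrK.
Qed.

Definition triangular_pair (M : bool -> 'I_N -> 'I_N -> {poly CC}) :=
  (forall bar (i j : 'I_N), (if bar then j < i else i < j)%N -> (M bar i j)`_0 = 0) /\
  (forall i, (M false i i)`_0 * (M true i i)`_0 = 1).

(** Column by column elimination from the left: column [b] of [M] is split off as a column matrix,
    and the quotient is again a triangular pair, with one more column of the identity. *)
Lemma triangular_realizable M : triangular_pair M ->
  realizable (fun bar => \matrix_(i, j) tq (M bar i j)).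
Proof.
suff H k : forall M, triangular_pair M ->
    (forall bar (i j : 'I_N), (j < N - k)%N -> tq (M bar i j) = (i == j)%:R) ->
    realizable (fun bar => \matrix_(i, j) tq (M bar i j)).
  by move=> triM; apply: (H N) => // bar i j; rewrite subnn.
elim: k => [|k IH] {}M triM idM.
  apply: eq_realizable (@realizable1 N K) => bar; apply/matrixP => i j; rewrite !mxE.
  by apply: idM; rewrite subn0.
have [Nk|kN] := leqP N k.
  by apply: IH => // bar i j; rewrite (eqP (Nk : (N - k == 0)%N)).
have bN : (N - k.+1 < N)%N by rewrite ltn_subrL (leq_trans _ kN).
pose b := Ordinal bN; have [tri diag] := triM.
have M0 bar : (M bar b b)`_0 != 0.
  apply/eqP => e; have /eqP := diag b.
  by case: bar e => ->; rewrite ?mulr0 ?mul0r eq_sym oner_eq0.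
pose u bar := sval (cid (tq_unit K (M0 bar))).
have [uK u0] : (forall bar, tq (M bar b b * u bar) = 1) /\
               (forall bar, (u bar)`_0 = ((M bar b b)`_0)^-1).
  by split=> bar; rewrite /u; case: cid => x [].
(* The inverse of the column matrix applied to [M], where [u] inverts the pivot up to degree K. *)
pose M' bar i j := if i == b then u bar * M bar b j else M bar i j - M bar i b * (u bar * M bar b j).
have adm : admissible b (fun bar a => M bar a b) by move=> bar a; apply: tri.
have tri' : triangular_pair M'.
  split=> [bar i j ij|i]; rewrite /M'.
    case: eqVneq ij => [->|ib] ij; first by rewrite coef0M tri ?mulr0.
    rewrite coefB !coef0M tri // sub0r.
    have [bi|bi] := boolP (if bar then b < i else i < b)%N; first by rewrite tri ?mul0r ?oppr0.
    rewrite [(M bar b j)`_0]tri ?mulr0 ?mulr0 ?oppr0 //.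
    by move: ib ij bi; rewrite -val_eqE; case: (bar) => /=; lia.
  case: eqVneq => [->|ib]; first by rewrite !coef0M !u0 !mulVf ?mulr1.
  rewrite !coefB !coef0M.
  have Z bar : (M bar i b)`_0 * ((u bar)`_0 * (M bar b i)`_0) = 0.
    have [bi|bi] := boolP (if bar then b < i else i < b)%N; first by rewrite tri ?mul0r.
    rewrite [(M bar b i)`_0]tri ?mulr0 //.
    by move: ib bi; rewrite -val_eqE; case: (bar) => /=; lia.
  by rewrite !Z !subr0.
have id' bar (i j : 'I_N) : (j < N - k)%N -> tq (M' bar i j) = (i == j)%:R.
  have -> : (N - k = (N - k.+1).+1)%N by lia.
  rewrite ltnS leq_eqVlt => /predU1P[jb|jb].
    have -> : j = b by apply: val_inj.
    rewrite /M' [u bar * _]mulrC; case: eqVneq => [_|ib]; first by rewrite uK.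
    by rewrite -mulNr tqD (tqM _ (- _)) uK mulr1 -tqD subrr tq0.
  have nbj : b == j = false by apply/negbTE; rewrite -val_eqE /= gtn_eqF.
  have Z : tq (M bar b j) = 0 by rewrite idM // nbj.
  rewrite /M'; case: eqVneq => [->|ib]; first by rewrite tqM Z mulr0 nbj.
  by rewrite -mulNr tqD !tqM Z !mulr0 addr0 idM.
apply: eq_realizable (realizableM (column_realizable adm (diag b)) (IH _ tri' id')) => bar.
apply/matrixP => i j; rewrite colmx_mulE !mxE /M' eqxx.
case: eqVneq => [->|ib]; first by rewrite -tqM mulrA tqM uK mul1r.
by rewrite mul1r -tqM -tqD subrK.
Qed.

Lemma prodQ_bmx (t : nat -> params N) m bar a b :
  tq (prodQ t m bar a b) = (\prod_(i < m) bmx K (t i) bar) a b.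
Proof.
elim: m a b => [|m IH] a b.
  rewrite big_ord0 /= /entry_one -[1 in RHS]/(1%:M) mxE.
  by case: eqP; rewrite ?tq1 ?tq0.
rewrite big_ord_recr /= -mulmxE mxE /entry_mul.
rewrite (big_morph tq (tqD K) (tq0 K)); apply: eq_bigr => e _.
by rewrite tqM IH mxE.
Qed.

Lemma classical_target (tau : gen N -> CC) : (0 < N)%N ->
  (forall x, zero_gen x -> tau x = 0) ->
  (forall i, tau (false, i, i, 0%N) * tau (true, i, i, 0%N) = 1) ->
  exists t m, forall x, (gdeg x <= K)%N -> classical_gen t m x = tau x.
Proof.
move=> N0 tau0 tau1.
pose M bar i j : {poly CC} := \poly_(r < K.+1) tau (bar, i, j, r).
have triM : triangular_pair M.
  split=> [bar i j ij|i]; rewrite !coef_poly //=.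
  by apply: tau0; rewrite /zero_gen /=; case: bar ij.
have [s sM] := triangular_realizable triM.
have d : params N := Params (Ordinal N0) (oner_neq0 CC) (fun _ : 'I_N => oner_neq0 CC) (oner_neq0 CC).
exists (nth d s), (size s) => -[[[bar i] j] r] rK; rewrite /classical_gen /=.
have e : tq (prodQ (nth d s) (size s) bar i j) = tq (M bar i j).
  have := congr1 (fun A : 'M_N => A i j) (sM bar); rewrite mxE => ->.
  by rewrite prodQ_bmx (big_nth d) big_mkord.
by have /tqP/(_ r rK)-> := e; rewrite coef_poly ltnS rK.
Qed.

End Factorization.

(** * Linear independence *)

Section Powers.
Variables (F : fieldType) (I : eqType) (ws : seq I) (rho a : I -> F).
Hypotheses (uws : uniq ws) (rho_inj : {in ws &, injective rho}).
Hypothesis rho0 : {in ws, forall w, rho w != 0}.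

(** Linear combinations replace the powers by [rho] times any polynomial in [rho]; the polynomial
    that vanishes at all nodes except the one of [w] isolates [a w]. *)
Lemma power_sums_independent :
  (forall j, \sum_(w <- ws) a w * rho w ^+ j.+1 = 0) -> {in ws, forall w, a w = 0}.
Proof.
move=> sum0 w w_ws.
have polysum (p : {poly F}) : \sum_(v <- ws) a v * rho v * p.[rho v] = 0.
  transitivity (\sum_(i < size p) p`_i * \sum_(v <- ws) a v * rho v ^+ i.+1); last first.
    by apply: big1 => i _; rewrite sum0 mulr0.
  under [RHS]eq_bigr do rewrite mulr_sumr.
  rewrite exchange_big; apply: eq_bigr => v _; rewrite horner_coef mulr_sumr.
  by apply: eq_bigr => i _; rewrite exprS; ring.
pose P := \prod_(v <- ws | v != w) ('X - (rho v)%:P).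
have P0 v : v \in ws -> v != w -> P.[rho v] = 0.
  move=> v_ws vw; apply/eqP; rewrite /P horner_prod prodf_seq_eq0.
  by apply/hasP; exists v => //; rewrite vw !hornerE subrr /=.
have Pw : P.[rho w] != 0.
  rewrite /P horner_prod prodf_seq_neq0; apply/allP => v v_ws; apply/implyP => vw.
  by rewrite !hornerE subr_eq0 (inj_in_eq rho_inj) // eq_sym.
have := polysum P; rewrite (bigD1_seq w) //= big1_seq ?addr0; last first.
  by move=> v /andP[vw v_ws]; rewrite P0 ?mulr0.
by move/eqP; rewrite !mulf_eq0 (negPf Pw) (negPf (rho0 w_ws)) !orbF => /eqP.
Qed.

End Powers.

Section Primes.
Fixpoint prime_seq (k : nat) : nat :=
  if k is k'.+1 then s2val (prime_above (prime_seq k')) else 2.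

Lemma prime_seqP k : prime (prime_seq k).
Proof. by case: k => [|k] //=; case: prime_above. Qed.

Lemma prime_seq_inj : injective prime_seq.
Proof.
have lt k : (prime_seq k < prime_seq k.+1)%N by rewrite /=; case: prime_above.
have mono := homo_ltn ltn_trans lt.
move=> i j e; case: (ltngtP i j) => // ij; have := mono _ _ ij; by rewrite e ltnn.
Qed.
End Primes.

Section Monomials.
Variable N : nat.
Implicit Types (x y : gen N) (w : seq (gen N)).

Definition gprime x : nat := prime_seq (pickle x).

Definition is_inverse x := [&& gbar x, grow x == gcol x & gdeg x == 0%N].
Definition inverse_base x : gen N := (false, grow x, gcol x, gdeg x).

(* The value of the inverse of t_ii^(0) is dictated by that of t_ii^(0). *)
Definition prime_weight x : CC :=
  if is_inverse x then (gprime (inverse_base x))%:R^-1 else (gprime x)%:R.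

Lemma gprime_neq0 x : (gprime x)%:R != 0 :> CC.
Proof.
apply/eqP => /(@CC_natr_inj _ 0) e.
by have := prime_gt0 (prime_seqP (pickle x)); rewrite -/(gprime x) e.
Qed.

Lemma prime_weight_neq0 x : prime_weight x != 0.
Proof. by rewrite /prime_weight; case: ifP => _; rewrite ?invr_eq0 gprime_neq0. Qed.

Definition prime_num w := (\prod_(x <- w | ~~ is_inverse x) gprime x)%N.
Definition prime_den w := (\prod_(x <- w | is_inverse x) gprime (inverse_base x))%N.

Lemma prime_den_neq0 w : (prime_den w)%:R != 0 :> CC.
Proof.
rewrite /prime_den natr_prod; elim/big_rec: _ => [|x k _ IH]; first exact: oner_neq0.
by rewrite mulf_neq0 ?gprime_neq0.
Qed.

Lemma prod_prime_weight w : \prod_(x <- w) prime_weight x = (prime_num w)%:R / (prime_den w)%:R.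
Proof.
rewrite /prime_num /prime_den; elim: w => [|x w IH]; first by rewrite !big_nil mulr1n divr1.
rewrite !big_cons IH /prime_weight; case: ifP => _ /=; rewrite natrM ?invfM; ring.
Qed.

Lemma logn_gprime x y : logn (gprime y) (gprime x) = (x == y).
Proof.
by rewrite logn_prime ?prime_seqP // (inj_eq prime_seq_inj) (inj_eq (pcan_inj pickleK)) eq_sym.
Qed.

Lemma prime_num_gt0 w : (0 < prime_num w)%N.
Proof. by apply: prodn_cond_gt0 => x _; apply/prime_gt0/prime_seqP. Qed.
Lemma prime_den_gt0 w : (0 < prime_den w)%N.
Proof. by apply: prodn_cond_gt0 => x _; apply/prime_gt0/prime_seqP. Qed.

Lemma logn_prime_num w y : logn (gprime y) (prime_num w) = if is_inverse y then 0%N else count_mem y w.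
Proof.
rewrite /prime_num; elim: w => [|x w IH]; first by rewrite big_nil logn1 if_same.
rewrite big_cons; case: ifP => ix /=; last first.
  by rewrite IH; case: ifP => // iy; case: eqP => // xy; rewrite xy iy in ix.
rewrite lognM ?prime_num_gt0 ?prime_gt0 ?prime_seqP // IH logn_gprime.
by case: ifP => // iy; case: eqP ix => // ->; rewrite iy.
Qed.

Lemma logn_prime_den w i : logn (gprime (false, i, i, 0%N)) (prime_den w) = count_mem (true, i, i, 0%N) w.
Proof.
rewrite /prime_den; elim: w => [|x w IH]; first by rewrite big_nil logn1.
rewrite big_cons; case: ifP => ix /=; last first.
  rewrite IH; case: eqP => // xi. by move: ix; rewrite xi /is_inverse /= !eqxx.
rewrite lognM ?prime_den_gt0 ?prime_gt0 ?prime_seqP // IH logn_gprime; congr (_ + _)%N.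
case: x ix => [[[b j] k] r]; rewrite /is_inverse /gbar /grow /gcol /gdeg /= => /and3P[-> /eqP <- /eqP ->].
by congr nat_of_bool; apply/eqP/eqP => -[->].
Qed.

Lemma logn_prime_den0 w y : y <> (false, grow y, grow y, 0%N) ->
  logn (gprime y) (prime_den w) = 0%N.
Proof.
move=> ny; rewrite /prime_den; elim: w => [|x w IH]; first by rewrite big_nil logn1.
rewrite big_cons; case: ifP => // ix.
rewrite lognM ?prime_den_gt0 ?prime_gt0 ?prime_seqP // IH logn_gprime.
case: eqP => // e; case: ny; rewrite -e; case: x ix {e} => [[[b j] k] r].
by rewrite /is_inverse /inverse_base /grow /gcol /gdeg /= => /and3P[_ /eqP <- /eqP ->].
Qed.

(** Unique factorization recovers all multiplicities, except that for t_ii^(0) and its inverse only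
    their difference is seen. An ordered monomial contains at most one of the two, so the difference
    determines both; and a sorted word is determined by its multiplicities. *)
Lemma ordered_weight_inj w w' : ordered_monomial w -> ordered_monomial w' ->
  \prod_(x <- w) prime_weight x = \prod_(x <- w') prime_weight x -> w = w'.
Proof.
case/and3P=> sw _ /forallP ew /and3P[sw' _ /forallP ew'].
rewrite !prod_prime_weight => /eqP; rewrite eqr_div ?prime_den_neq0 // -!natrM => /eqP/CC_natr_inj e.
have cnt y : (logn (gprime y) (prime_num w) + logn (gprime y) (prime_den w') =
              logn (gprime y) (prime_num w') + logn (gprime y) (prime_den w))%N.
  by rewrite -!lognM ?prime_num_gt0 ?prime_den_gt0 // e.
have diag i : count_mem (false, i, i, 0%N) w = count_mem (false, i, i, 0%N) w' /\
              count_mem (true, i, i, 0%N) w = count_mem (true, i, i, 0%N) w'.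
  have := cnt (false, i, i, 0%N); rewrite !logn_prime_num !logn_prime_den.
  have -> : is_inverse (false, i, i, 0%N) = false by [].
  have := ew i; have := ew' i; rewrite -!has_pred1 !has_count.
  by move: (count _ _) (count _ _) (count _ _) (count _ _); lia.
apply: (sorted_eq (@gen_le_trans N) _ sw sw'); first exact: gen_le_anti.
apply/allP => y _ /=; apply/eqP.
have [iy|niy] := boolP (is_inverse y).
  case: y iy => [[[b j] k] r]; rewrite /is_inverse /gbar /grow /gcol /gdeg /=.
  by case/and3P=> -> /eqP <- /eqP ->; have [] := diag j.
have [ey|ny] := eqVneq y (false, grow y, grow y, 0%N).
  by rewrite ey; have [] := diag (grow y).
have := cnt y; rewrite !logn_prime_num (negPf niy) !logn_prime_den0 ?addn0 //; exact/eqP.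
Qed.

Lemma prime_weight_inverse i : prime_weight (false, i, i, 0%N) * prime_weight (true, i, i, 0%N) = 1.
Proof.
have -> : prime_weight (true, i, i, 0%N) = (prime_weight (false, i, i, 0%N))^-1.
  by rewrite /prime_weight /is_inverse /gbar /grow /gcol /gdeg /= eqxx.
by rewrite mulfV ?prime_weight_neq0.
Qed.

Lemma classical_independence (ws : seq (seq (gen N))) (a : seq (gen N) -> CC) :
  (0 < N)%N -> uniq ws -> all ordered_monomial ws ->
  (forall t m, \sum_(w <- ws) a w * \prod_(x <- w) classical_gen t m x = 0) ->
  {in ws, forall w, a w = 0}.
Proof.
move=> N0 uws /allP ows sum0.
pose rho w := \prod_(x <- w) prime_weight x.
apply: (@power_sums_independent _ _ ws rho a) => //.
- by move=> w w' /ows ow /ows ow'; apply: ordered_weight_inj.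
- by move=> w _; rewrite /rho prodf_seq_neq0; apply/allP => x _; rewrite prime_weight_neq0.
move=> j.
(* Realization is exact only up to degree [K], which therefore bounds the degrees of all generators
   that occur. Taking powers of the weights keeps those of t_ii^(0) and its inverse reciprocal. *)
pose K := \max_(x <- flatten ws) gdeg x.
pose tau x := if zero_gen x then 0 else prime_weight x ^+ j.+1.
have [x|i|t [m tm]] := @classical_target N K tau N0.
- by rewrite /tau => ->.
- by rewrite /tau /zero_gen /= ltnn -exprMn prime_weight_inverse expr1n.
rewrite -[RHS](sum0 t m) big_seq [RHS]big_seq; apply: eq_bigr => w w_ws; congr (_ * _).
rewrite /rho -prodrXl big_seq [RHS]big_seq; apply: eq_bigr => x xw.
rewrite tm; last by apply: leq_bigmax_seq => //; apply/flattenP; exists w.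
by case/and3P: (ows _ w_ws) => _ /allP/(_ x xw) /negPf nz _; rewrite /tau nz.
Qed.

End Monomials.

Section Independence.
Variables (N : nat) (ws : seq (seq (gen N))).
Hypotheses (N0 : (0 < N)%N) (uws : uniq ws) (ows : all ordered_monomial ws).

Definition block_gen (t : nat -> params N) m : gen N -> endo N :=
  poly_gen (prodP (fun i => block_of (t i)) m).

Lemma zL1_torsion (f : endo N) : (zL - 1) *: f = 0 -> f = 0.
Proof.
move=> f0; apply: endoP => u s.
have /laurent_idomain[e|//] : (zL - 1) * f u s = 0.
  by have := congr1 (fun h : endo N => h u s) f0.
have : lpoly ('X - 1) = 0 by rewrite lpolyB lpolyX lpoly1.
by move/lpoly_eq0/eqP; rewrite polyXsubC_eq0.
Qed.

Lemma value_at_one (p : seq (gen N) -> {poly CC}) t m :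
  \sum_(w <- ws) lpoly (p w) *: monomial (block_gen t m) w = 0 ->
  \sum_(w <- ws) (p w).[1] * \prod_(x <- w) classical_gen t m x = 0.
Proof.
set k := (X in _ -> X = 0) => f0.
have : ocong (\sum_(w <- ws) lpoly (p w) *: monomial (block_gen t m) w) k.
  by apply: ocong_sum => w; apply: ocongZ (cong1_poly _) _; apply: monomial_cong.
rewrite f0 => /(_ (fun=> 1) 1 (fun=> cong1_1) (fun _ _ => 0)); rewrite mulr1.
by move/cong1_uniq; apply; apply: cong1_0.
Qed.

Lemma polynomial_independence (p : seq (gen N) -> {poly CC}) :
  (forall t m, \sum_(w <- ws) lpoly (p w) *: monomial (block_gen t m) w = 0) ->
  {in ws, forall w, p w = 0}.
Proof.
(* Division by X - 1 lowers the total size as soon as one polynomial is nonzero, and the quotients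
   satisfy the same relation because multiplication by z - 1 is injective on operators. *)
have [k] := ubnP (\sum_(w <- ws) size (p w)); elim: k p => // k IH p sz sum0.
have p1 : {in ws, forall w, (p w).[1] = 0}.
  by apply: classical_independence => // t m; apply: value_at_one.
have [/hasP[w0 w0_ws pw0]|/hasPn p0] := boolP (has (fun w => p w != 0) ws); last first.
  by move=> w /p0; rewrite negbK => /eqP.
pose q w := p w %/ ('X - 1%:P).
have pq : {in ws, forall w, p w = q w * ('X - 1%:P)}.
  by move=> w w_ws; rewrite divpK // dvdp_XsubCl /root p1.
suff q0 : {in ws, forall w, q w = 0} by move=> w w_ws; rewrite pq // q0 // mul0r.
apply: IH => [|t m].
  rewrite -ltnS; apply: leq_trans sz.
  rewrite ltnS !(big_rem w0 w0_ws) /= -addSn; apply: leq_add.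
    by rewrite size_divp ?polyXsubC_eq0 // size_XsubC subn1 prednK ?size_poly_gt0.
  by apply: leq_sum => w _; rewrite leq_divp.
apply: zL1_torsion; rewrite scaler_sumr -[RHS](sum0 t m) big_seq [RHS]big_seq.
apply: eq_bigr => w w_ws; rewrite scalerA (pq w) // mulrC lpolyM lpolyB lpolyX polyC1 lpoly1.
by [].
Qed.

End Independence.

Lemma zLX_inj n (x : Laurent) : zL ^+ n * x = 0 -> x = 0.
Proof. by move=> e; rewrite -[x]mul1r -(expr1n _ n) -zLinv_zL exprMn -mulrA e mulr0. Qed.

Lemma ordered_monomials_independent N (A : algType Laurent) (g : gen N -> A) :
  (0 < N)%N -> presents_Uz g ->
  forall (ws : seq (seq (gen N))) (c : seq (gen N) -> Laurent),
  uniq ws -> all ordered_monomial ws ->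
  \sum_(w <- ws) c w *: monomial g w = 0 ->
  forall w, w \in ws -> c w = 0.
Proof.
move=> N0 [_ univ] ws c uws ows sum0.
pose n w := sval (cid (laurent_clear (c w))).
have [p pP] := choice (fun w => svalP (cid (laurent_clear (c w)))).
(* A common power of z that clears all coefficients; it is removed at the end because z is a
   unit. *)
pose M := (\sum_(w <- ws) n w)%N.
pose P w := 'X^(M - n w) * p w.
have PE : {in ws, forall w, zL ^+ M * c w = lpoly (P w)}.
  by move=> w w_ws; rewrite /P -pP subnKC // /M (big_rem w w_ws) leq_addr.
have P0 : {in ws, forall w, P w = 0}.
  apply: polynomial_independence => // t m.
  have [f [fg _]] := univ _ _ (prodP_relations (fun i => block_of (t i)) m).
  have fM w : f (monomial g w) = monomial (block_gen t m) w.
    rewrite /monomial rmorph_prod; apply: eq_bigr => x _; exact: fg.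
  have fZ r x : f (r *: x) = r *: f x by apply: linearZ.
  transitivity (zL ^+ M *: f (\sum_(w <- ws) c w *: monomial g w)); last first.
    by rewrite sum0 [f 0](raddf0 f) scaler0.
  rewrite (raddf_sum f) scaler_sumr big_seq [RHS]big_seq; apply: eq_bigr => w w_ws.
  by rewrite -PE // -scalerA -fM -fZ.
by move=> w w_ws; apply: (@zLX_inj M); rewrite PE // P0 // lpoly0.
Qed.

Theorem theorem2p11 (N : nat) (A : algType Laurent) (g : gen N -> A) :
  (1 <= N)%N ->
  presents_Uz g ->
  (* the ordered monomials span A over C[z,z^-1] *)
  (forall x : A, exists (ws : seq (seq (gen N))) (c : seq (gen N) -> Laurent),
      all ordered_monomial ws /\ x = \sum_(w <- ws) c w *: monomial g w) /\
  (* and are linearly independent over C[z,z^-1] *)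
  (forall (ws : seq (seq (gen N))) (c : seq (gen N) -> Laurent),
      uniq ws -> all ordered_monomial ws ->
      \sum_(w <- ws) c w *: monomial g w = 0 ->
      forall w, w \in ws -> c w = 0).
Proof.
move=> N0 pres; split; first exact: ordered_monomials_span pres.
exact: ordered_monomials_independent N0 pres.
Qed.
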